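(* Let $K$ be a field. There is an algorithm which, given an $m\times n$ bigraded matrix $[\gamma]$ representing a morphism $\gamma:F\to F'$ of finitely generated free bipersistence modules, computes a minimal set of (homogeneous) generators of $\operatorname{im}\gamma$ in $O(mn\cdot\min(m,n)+n^2)$ time and $O(mn)$ memory.
   Context: A bipersistence module is a $K[x_1,x_2]$-module $M$ with a vector space decomposition $M=\bigoplus_{\mathbf z\in\mathbb Z^2}M_{\mathbf z}$ such that $x_iM_{\mathbf z}\subset M_{\mathbf z+\mathbf e_i}$. Morphisms are module homomorphisms preserving grades. $\mathbb Z^2$ carries the product partial order. A bipersistence module is free if it is isomorphic to a direct sum of modules $Q^{\mathbf g}$, $\mathbf g\in\mathbb Z^2$, where $Q^{\mathbf g}_{\mathbf z}=K$ if $\mathbf g\le\mathbf z$ and $0$ otherwise, with identity maps between the copies of $K$. A basis of a free module is a minimal homogeneous generating set. For a homogeneous element $b$, $\mathrm{gr}(b)$ is its grade. Given an ordered basis $B$ of a finitely generated free module $F$ and $v\in F_{\mathbf z}$, $[v]^B\in K^{|B|}$ is the unique vector with $[v]^B_i=0$ if $\mathrm{gr}(B_i)\not\le\mathbf z$ and $v=\sum_{i:\mathrm{gr}(B_i)\le \mathbf z}[v]^B_i x^{\mathbf z-\mathrm{gr}(B_i)}B_i$. A morphism $\gamma:F\to F'$ with ordered bases $B,B'$ is represented by the matrix over $K$ whose $j$-th column is $[\gamma(B_j)]^{B'}$ and is labeled by $\mathrm{gr}(B_j)$. A bigraded matrix is a matrix over $K$ with each column labeled by an element of $\mathbb Z^2$,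 the labels appearing in colexicographical order (so $B$ is colexicographically ordered by grade). The output is a list of pairs $(v,\mathbf z)\in K^m\times\mathbb Z^2$, the pair $(v,\mathbf z)$ standing for the element of $F'_{\mathbf z}$ whose coordinate vector with respect to $B'$ is $v$. Cost model: an elementary arithmetic operation in $K$ takes $O(1)$ time and storing an element of $K$ takes $O(1)$ memory (and likewise for labels in $\mathbb Z^2$). *)

(* Defs.v *)
From HB Require Import structures.
From mathcomp Require Import all_boot all_order all_algebra.
From mathcomp Require Import freeg mpoly.

Set Implicit Arguments.
Unset Strict Implicit.
Unset Printing Implicit Defensive.

Import Order.TTheory GRing.Theory Num.Theory.

Local Open Scope ring_scope.

(* [(g <= z)%O] on this type is the componentwise order. *)
Notation grade := (int *p int)%type.

(* The second coordinate is the most significant one. *)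
Definition colex_le (g z : grade) : bool :=
  (((g.2, g.1) : int *l int) <= ((z.2, z.1) : int *l int))%O.

Definition grade_shift (i : 'I_2) (z : grade) : grade :=
  if i == 0 then (z.1 + 1, z.2) else (z.1, z.2 + 1).

(* x^(z - g); only meaningful when (g <= z)%O, since absz is used to turn the
   coordinates of z - g into exponents. *)
Definition xpow (K : fieldType) (g z : grade) : {mpoly K[2]} :=
  'X_0 ^+ `|z.1 - g.1|%N * 'X_1 ^+ `|z.2 - g.2|%N.

(* The K-vector space structure is the one obtained by restricting scalars
   along the constant polynomials c%:MP.  [bp_span] and [bp_indep] say that
   the module is the (internal) direct sum of its pieces. *)
Record bipersModule (K : fieldType) := BipersModule {
  bp_sort :> lmodType {mpoly K[2]};
  piece : grade -> bp_sort -> Prop;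
  bp_zero : forall z, piece z 0;
  bp_linear : forall z (c : K) u v,
    piece z u -> piece z v -> piece z (c%:MP *: u + v);
  bp_shift : forall z (i : 'I_2) v,
    piece z v -> piece (grade_shift i z) ('X_i *: v);
  bp_span : forall v : bp_sort, exists s : seq bp_sort,
    (forall u, u \in s -> exists z, piece z u) /\ v = \sum_(u <- s) u;
  bp_indep : forall (zs : seq grade) (f : grade -> bp_sort),
    uniq zs -> (forall z, z \in zs -> piece z (f z)) ->
    \sum_(z <- zs) f z = 0 -> forall z, z \in zs -> f z = 0
}.

Definition homogeneous (K : fieldType) (M : bipersModule K) (v : M) : Prop :=
  exists z, piece z v.

Record bipersMorphism (K : fieldType) (M N : bipersModule K) := BipersMorphism {
  bp_fun :> {linear M -> N};
  bp_fun_piece : forall z v, piece z v -> piece z (bp_fun v)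
}.

Definition bipers_iso (K : fieldType) (M N : bipersModule K) : Prop :=
  exists (f : bipersMorphism M N) (h : bipersMorphism N M),
    cancel f h /\ cancel h f.

Definition image (K : fieldType) (M N : bipersModule K)
    (f : bipersMorphism M N) (w : N) : Prop :=
  exists v : M, w = f v.

(* Q^g has underlying K[x1,x2]-module K[x1,x2]: the copy of K in grade z >= g
   is K . x^(z - g), so that multiplication by x^(z' - z) is the identity of
   K from the copy in grade z to the copy in grade z'. *)
Definition Qpiece (K : fieldType) (g z : grade) (p : {mpoly K[2]}) : Prop :=
  exists c : K, p = if (g <= z)%O then c *: xpow K g z else 0.

(* The direct sum of the Q^(g i), i in I: {freeg I / R} is the R-module of
   finitely supported functions from I to R. *)
Section DirectSumQ.
Context (K : fieldType) (I : choiceType) (g : I -> grade).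
Local Notation R := {mpoly K[2]}.
Local Notation M := {freeg I / R}.

Definition dsumQ_piece (z : grade) (D : M) : Prop :=
  forall i, Qpiece (g i) z (coeff i D).

Let mon (a b : nat) : 'X_{1..2} := [multinom (if i == ord0 then a else b) | i < 2].

Lemma mpolyX_mon a b : 'X_0 ^+ a * 'X_1 ^+ b = 'X_[mon a b] :> R.
Proof.
rewrite [RHS]mpolyXE_id /= big_ord_recl big_ord1 !mnmE /=.
by congr (_ * 'X__ ^+ _); apply/val_inj.
Qed.

Lemma Qpiece_coef h z (p : R) (m : 'X_{1..2}) :
  Qpiece h z p -> p@_m != 0 -> z = (h.1 + (m 0)%:Z, h.2 + (m 1)%:Z) :> grade.
Proof.
case=> c ->; case: ifP => [hz|_]; last by rewrite mcoeff0 eqxx.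
rewrite mcoeffZ /xpow mpolyX_mon mcoeffX; case: (_ =P m) => [<- _|_]; last first.
  by rewrite mulr0 eqxx.
move: hz; rewrite leEprod => /andP[h1 h2]; rewrite !mnmE /=.
by case: z h1 h2 => z1 z2 /= h1 h2; rewrite !gez0_abs ?subr_ge0 // !subrKC.
Qed.

Lemma QpieceX h c (m : 'X_{1..2}) :
  Qpiece h (h.1 + (m 0)%:Z, h.2 + (m 1)%:Z) (c *: 'X_[m] : R).
Proof.
exists c; rewrite leEprod /= !lerDl /= /xpow mpolyX_mon; congr (_ *: 'X_[_]).
apply/mnmP => i; rewrite mnmE /= ![_ + _ - _]addrAC !subrr !add0r !absz_nat.
case: i => [[|[|]]] //= hi; rewrite -?val_eqE /=.
  by congr (m _); apply/val_inj.
by congr (m _); apply/val_inj.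
Qed.

Lemma Qpiece0 h z : Qpiece h z (0 : R).
Proof. by exists 0; rewrite scale0r if_same. Qed.

Lemma dsumQ_zero z : dsumQ_piece z 0.
Proof. by move=> i; rewrite coeff0; apply: Qpiece0. Qed.

Lemma dsumQ_linear z (c : K) (u v : M) :
  dsumQ_piece z u -> dsumQ_piece z v -> dsumQ_piece z (c%:MP *: u + v).
Proof.
move=> hu hv i; have [a ha] := hu i; have [b hb] := hv i.
exists (c * a + b); rewrite coeffD coeffZ ha hb mul_mpolyC.
by case: ifP => _; rewrite ?scaler0 ?addr0 // scalerA -scalerDl.
Qed.

Lemma dsumQ_shift z (k : 'I_2) (v : M) :
  dsumQ_piece z v -> dsumQ_piece (grade_shift k z) ('X_k *: v).
Proof.
move=> hv i; have [c hc] := hv i; rewrite coeffZ hc.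
case: ifP => [hz|_]; last by rewrite mulr0; apply: Qpiece0.
rewrite -scalerAr /xpow mpolyX_mon -mpolyXD.
set m := (_ + _)%MM; suff -> : grade_shift k z
    = ((g i).1 + (m 0)%:Z, (g i).2 + (m 1)%:Z) by exact: QpieceX.
move: hz; rewrite leEprod /m !mnmDE !mnmE /= => /andP[h1 h2].
have aux (a b d : int) : a + (d + (b - a)) = b + d.
  by rewrite addrCA subrKC addrC.
rewrite !PoszD !gez0_abs ?subr_ge0 // !aux.
by case: k {m} => [[|[|]]] //= hk; rewrite ?addr0.
Qed.

Lemma dsumQ_span (v : M) : exists s : seq M,
  (forall u, u \in s -> exists z, dsumQ_piece z u) /\ v = \sum_(u <- s) u.
Proof.
exists (flatten [seq [seq << (coeff i v)@_m *: 'X_[m] *g i >>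
                        | m <- msupp (coeff i v)] | i <- dom v]); split.
  move=> u /flatten_mapP[i _ /mapP[m _ ->]].
  exists ((g i).1 + (m 0)%:Z, (g i).2 + (m 1)%:Z) => j.
  rewrite coeffU; case: eqP => [<-|_]; rewrite ?mulr1 ?mulr0; last exact: Qpiece0.
  exact: QpieceX.
rewrite big_flatten big_map -[LHS]freeg_sumE; apply: eq_bigr => i _.
rewrite big_map {1}[coeff i v]mpolyE; apply/eqP/freeg_eqP => j.
rewrite coeffU raddf_sum mulr_suml; apply: eq_bigr => m _.
by rewrite [RHS]coeffU.
Qed.

Lemma dsumQ_indep (zs : seq grade) (f : grade -> M) :
  uniq zs -> (forall z, z \in zs -> dsumQ_piece z (f z)) ->
  \sum_(z <- zs) f z = 0 -> forall z, z \in zs -> f z = 0.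
Proof.
move=> uzs hf sum0 z zzs; apply/eqP/freeg_eqP => i; rewrite coeff0.
apply/mpolyP => m; rewrite mcoeff0; apply/eqP/negP => /negP nz.
have zE := Qpiece_coef (hf _ zzs i) nz.
have := congr1 (fun D => (coeff i D)@_m) sum0.
rewrite raddf_sum /= raddf_sum coeff0 mcoeff0 (bigD1_seq z) //= big1_seq ?addr0.
  by move/eqP; apply/negP.
move=> z' /andP[z'z z'zs]; apply/eqP/negP => /negP nz'; case/eqP: z'z.
by rewrite zE (Qpiece_coef (hf _ z'zs i) nz').
Qed.

Definition dsumQ : bipersModule K :=
  BipersModule dsumQ_zero dsumQ_linear dsumQ_shift dsumQ_span dsumQ_indep.

End DirectSumQ.

Definition free_module (K : fieldType) (M : bipersModule K) : Prop :=
  exists (I : choiceType) (g : I -> grade), bipers_iso M (dsumQ K g).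

Definition mspan (K : fieldType) (M : bipersModule K) (S : M -> Prop) (v : M)
    : Prop :=
  exists l : seq ({mpoly K[2]} * M),
    (forall p, p \in l -> S p.2) /\ v = \sum_(p <- l) p.1 *: p.2.

Definition generates (K : fieldType) (M : bipersModule K) (S N : M -> Prop)
    : Prop :=
  forall v, mspan S v <-> N v.

Definition finitely_generated (K : fieldType) (M : bipersModule K) : Prop :=
  exists s : seq M, generates (fun v => v \in s) (fun _ => True).

Definition minimal_homogeneous_generators (K : fieldType) (M : bipersModule K)
    (S N : M -> Prop) : Prop :=
  [/\ forall v, S v -> homogeneous v,
      generates S N
    & forall S' : M -> Prop,
        (forall v, S' v -> S v) -> generates S' N -> forall v, S v -> S' v].

(* [gr i] is the grade of [B i]; it is determined by [B], as the elements of a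
   minimal generating set are nonzero. *)
Definition ordered_basis (K : fieldType) (M : bipersModule K) (n : nat)
    (B : 'I_n -> M) (gr : 'I_n -> grade) : Prop :=
  [/\ injective B,
      forall i, piece (gr i) (B i)
    & minimal_homogeneous_generators (fun v => exists i, v = B i)
        (fun _ => True)].

Definition of_coords (K : fieldType) (M : bipersModule K) (n : nat)
    (B : 'I_n -> M) (gr : 'I_n -> grade) (z : grade) (c : 'cV[K]_n) : M :=
  \sum_(i < n | (gr i <= z)%O) (c i 0 *: xpow K (gr i) z) *: B i.

(* c = [v]^B for v in grade z *)
Definition is_coords (K : fieldType) (M : bipersModule K) (n : nat)
    (B : 'I_n -> M) (gr : 'I_n -> grade) (z : grade) (v : M) (c : 'cV[K]_n)
    : Prop :=
  (forall i, ~~ (gr i <= z)%O -> c i 0 = 0) /\ v = of_coords B gr z c.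

Record bigradedMatrix (K : fieldType) (m n : nat) := BigradedMatrix {
  bg_mx :> 'M[K]_(m, n);
  bg_label : 'I_n -> grade;
  bg_sorted : forall i j : 'I_n, (i <= j)%N -> colex_le (bg_label i) (bg_label j)
}.

Definition represents (K : fieldType) (m n : nat) (F F' : bipersModule K)
    (A : bigradedMatrix K m n) (gamma : bipersMorphism F F')
    (B : 'I_n -> F) (gr : 'I_n -> grade)
    (B' : 'I_m -> F') (gr' : 'I_m -> grade) : Prop :=
  forall j, bg_label A j = gr j /\
            is_coords B' gr' (gr j) (gamma (B j)) (col j A).

Local Open Scope nat_scope.

(* A random access machine over K.
   The memory consists of arrays with two indices, named by the natural numbers
   occurring in the program text.  There are three kinds of arrays: the cells
   contain array indices, coordinates of grades, or elements of K.
   - Indices can only be incremented, decremented and compared.  Hence they are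
     bounded by max(m, n) plus the running time up to a constant, and large
     amounts of data cannot be packed into a single index cell.
   - Coordinates of grades can only be copied and compared.
   - Elements of K are subject to the field operations and zero tests (division
     by zero yields zero, as in the library; programs can test before dividing).
   Programs do not contain elements of K other than 0 and 1. *)
Inductive kind := Idx | Crd | Scl.

Definition kind_eq_dec (x y : kind) : {x = y} + {x <> y}.
Proof. by decide equality. Defined.

HB.instance Definition _ := hasDecEq.Build kind (compareP kind_eq_dec).

(* kind, array name, first index, second index *)
Notation cell := (kind * nat * nat * nat)%type.

Record state (K : Type) := State {
  idx : nat -> nat -> nat -> nat;
  crd : nat -> nat -> nat -> int;
  scl : nat -> nat -> nat -> K
}.

Definition upd (T : Type) (f : nat -> nat -> nat -> T) (a i j : nat) (x : T) :=
  fun a' i' j' : nat => if [&& a' == a, i' == i & j' == j] then x else f a' i' j'.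

Inductive iexp :=
| IConst of nat
| IRead of nat & iexp & iexp
| ISucc of iexp
| IPred of iexp.

Inductive cexp :=
| CRead of nat & iexp & iexp.

Inductive kexp :=
| KZero
| KOne
| KRead of nat & iexp & iexp
| KAdd of kexp & kexp
| KSub of kexp & kexp
| KMul of kexp & kexp
| KDiv of kexp & kexp.

Inductive bexp :=
| BIdxLe of iexp & iexp
| BCrdLe of cexp & cexp
| BIsZero of kexp
| BNot of bexp
| BAnd of bexp & bexp.

Inductive cmd :=
| Skip
| SetIdx of nat & iexp & iexp & iexp
| SetCrd of nat & iexp & iexp & cexp
| SetScl of nat & iexp & iexp & kexp
| Seq of cmd & cmd
| If of bexp & cmd & cmd
| While of bexp & cmd.

Section Values.
Context (K : fieldType) (s : state K).

Fixpoint ival (e : iexp) : nat :=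
  match e with
  | IConst k => k
  | IRead a i j => idx s a (ival i) (ival j)
  | ISucc e1 => (ival e1).+1
  | IPred e1 => (ival e1).-1
  end.

Definition cval (e : cexp) : int :=
  let: CRead a i j := e in crd s a (ival i) (ival j).

Fixpoint kval (e : kexp) : K :=
  match e with
  | KZero => 0%R
  | KOne => 1%R
  | KRead a i j => scl s a (ival i) (ival j)
  | KAdd e1 e2 => (kval e1 + kval e2)%R
  | KSub e1 e2 => (kval e1 - kval e2)%R
  | KMul e1 e2 => (kval e1 * kval e2)%R
  | KDiv e1 e2 => (kval e1 / kval e2)%R
  end.

Fixpoint bval (e : bexp) : bool :=
  match e with
  | BIdxLe e1 e2 => (ival e1 <= ival e2)%N
  | BCrdLe e1 e2 => (cval e1 <= cval e2)%R
  | BIsZero e1 => kval e1 == 0%R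
  | BNot e1 => ~~ bval e1
  | BAnd e1 e2 => bval e1 && bval e2
  end.

Fixpoint ireads (e : iexp) : seq cell :=
  match e with
  | IConst _ => [::]
  | IRead a i j => (Idx, a, ival i, ival j) :: ireads i ++ ireads j
  | ISucc e1 | IPred e1 => ireads e1
  end.

Definition creads (e : cexp) : seq cell :=
  let: CRead a i j := e in (Crd, a, ival i, ival j) :: ireads i ++ ireads j.

Fixpoint kreads (e : kexp) : seq cell :=
  match e with
  | KZero | KOne => [::]
  | KRead a i j => (Scl, a, ival i, ival j) :: ireads i ++ ireads j
  | KAdd e1 e2 | KSub e1 e2 | KMul e1 e2 | KDiv e1 e2 => kreads e1 ++ kreads e2
  end.

Fixpoint breads (e : bexp) : seq cell :=
  match e with
  | BIdxLe e1 e2 => ireads e1 ++ ireads e2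
  | BCrdLe e1 e2 => creads e1 ++ creads e2
  | BIsZero e1 => kreads e1
  | BNot e1 => breads e1
  | BAnd e1 e2 => breads e1 ++ breads e2
  end.

End Values.

(* Evaluation time: one unit per constant, memory access and operation. *)
Fixpoint icost (e : iexp) : nat :=
  match e with
  | IConst _ => 1
  | IRead _ i j => (icost i + icost j).+1
  | ISucc e1 | IPred e1 => (icost e1).+1
  end.

Definition ccost (e : cexp) : nat :=
  let: CRead _ i j := e in (icost i + icost j).+1.

Fixpoint kcost (e : kexp) : nat :=
  match e with
  | KZero | KOne => 1
  | KRead _ i j => (icost i + icost j).+1
  | KAdd e1 e2 | KSub e1 e2 | KMul e1 e2 | KDiv e1 e2 => (kcost e1 + kcost e2).+1
  end.

Fixpoint bcost (e : bexp) : nat :=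
  match e with
  | BIdxLe e1 e2 => (icost e1 + icost e2).+1
  | BCrdLe e1 e2 => (ccost e1 + ccost e2).+1
  | BIsZero e1 => (kcost e1).+1
  | BNot e1 => (bcost e1).+1
  | BAnd e1 e2 => (bcost e1 + bcost e2).+1
  end.

(* [exec p s t c s']: started in state s, the program p terminates in state s'
   after time t, and c lists the cells it has read or written. *)
Inductive exec (K : fieldType) :
    cmd -> state K -> nat -> seq cell -> state K -> Prop :=
| ExecSkip s : exec Skip s 1 [::] s
| ExecSetIdx a i j e s :
    exec (SetIdx a i j e) s (icost i + icost j + icost e).+1
      ((Idx, a, ival s i, ival s j) :: ireads s i ++ ireads s j ++ ireads s e)
      (State (upd (idx s) a (ival s i) (ival s j) (ival s e)) (crd s) (scl s))
| ExecSetCrd a i j e s :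
    exec (SetCrd a i j e) s (icost i + icost j + ccost e).+1
      ((Crd, a, ival s i, ival s j) :: ireads s i ++ ireads s j ++ creads s e)
      (State (idx s) (upd (crd s) a (ival s i) (ival s j) (cval s e)) (scl s))
| ExecSetScl a i j e s :
    exec (SetScl a i j e) s (icost i + icost j + kcost e).+1
      ((Scl, a, ival s i, ival s j) :: ireads s i ++ ireads s j ++ kreads s e)
      (State (idx s) (crd s) (upd (scl s) a (ival s i) (ival s j) (kval s e)))
| ExecSeq p1 p2 s1 t1 c1 s2 t2 c2 s3 :
    exec p1 s1 t1 c1 s2 -> exec p2 s2 t2 c2 s3 ->
    exec (Seq p1 p2) s1 (t1 + t2) (c1 ++ c2) s3
| ExecIf b p1 p2 s t c s' :
    exec (if bval s b then p1 else p2) s t c s' ->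
    exec (If b p1 p2) s (bcost b + t).+1 (breads s b ++ c) s'
| ExecWhileStop b p s :
    ~~ bval s b -> exec (While b p) s (bcost b).+1 (breads s b) s
| ExecWhileStep b p s1 t1 c1 s2 t2 c2 s3 :
    bval s1 b -> exec p s1 t1 c1 s2 -> exec (While b p) s2 t2 c2 s3 ->
    exec (While b p) s1 (bcost b + t1 + t2).+1 (breads s1 b ++ c1 ++ c2) s3.

(* The number of distinct cells accessed in the whole run, those holding the input or
   the output included. *)
Definition memory_used (c : seq cell) : nat := size (undup c).

(* Input: the arrays named 0 contain the dimensions m, n (at (0,0), (0,1)), the
   labels (the label of column j at (j,0), (j,1)) and the entries of the
   matrix; the rest of the memory is filled with zeros. *)
Definition input (K : fieldType) (m n : nat) (A : bigradedMatrix K m n)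
    : state K :=
  State
    (fun a i j => if [&& a == 0, i == 0 & j == 0] then m
                  else if [&& a == 0, i == 0 & j == 1] then n else 0)
    (fun a i j => if a == 0 then
                    if insub i is Some i' then
                      if j == 0 then (bg_label A i').1
                      else if j == 1 then (bg_label A i').2 else 0%R
                    else 0%R
                  else 0%R)
    (fun a i j => if a == 0 then
                    if (insub i, insub j) is (Some i', Some j') then A i' j'
                    else 0%R
                  else 0%R).

(* Output: the arrays named 1 contain the number of pairs (at (0,0)), the grade
   of pair k (at (k,0), (k,1)), and the vector of pair k (in column k). *)
Definition output (K : fieldType) (m : nat) (s : state K)
    : seq ('cV[K]_m * grade) :=
  [seq (\col_(i < m) scl s 1 i k, (crd s 1 k 0, crd s 1 k 1))
     | k <- iota 0 (idx s 1 0 0)].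

(* The list out, read through the basis B', is a minimal set of homogeneous
   generators of im gamma, without repetition. *)
Definition lists_minimal_generators (K : fieldType) (m : nat)
    (F F' : bipersModule K) (gamma : bipersMorphism F F')
    (B' : 'I_m -> F') (gr' : 'I_m -> grade) (out : seq ('cV[K]_m * grade))
    : Prop :=
  let elt (p : 'cV[K]_m * grade) := of_coords B' gr' p.2 p.1 in
  [/\ forall p, p \in out -> is_coords B' gr' p.2 (elt p) p.1,
      uniq (map elt out)
    & minimal_homogeneous_generators (fun w => w \in map elt out)
        (image gamma)].

(* Main.v *)
Require Import Defs.
From mathcomp Require Import all_boot all_order all_algebra.
From mathcomp Require Import freeg mpoly zify.

(** Write [v_j] for the columns of the matrix and [x_j] for the first coordinates
    of their grades.  By the colexicographical order, the grade of a column
    [i < j] is at most that of column [j] exactly when [x_i <= x_j].  The images of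
    those basis elements whose column [v_j] is not in the span of the [v_i] with
    [i < j] and [x_i <= x_j] form a minimal set of generators of the image
    ([selected_columns_minimal]): an unselected column is a combination of earlier
    ones, and conversely the component of a relation in the grade of one of its
    members is a linear relation between columns, whose last member cannot be
    selected.  The converse needs coordinates with respect to the given basis of
    the target to be unique.  As a basis is only defined as a minimal homogeneous
    generating set, this rests on [basis_indep]: in a free module such a set is
    linearly independent over the polynomial ring.

    The spans of the columns seen so far form a filtration indexed by the abscissa
    [t].  The algorithm keeps a basis in echelon form that is adapted to this
    filtration: the basis vectors have distinct leading rows, and for every [t]
    those of abscissa at most [t] span the step [t].  A new column is reduced from
    the top row down.  When its leading row is taken by a basis vector of smaller or
    equal abscissa, that vector is used to clear the entry; when the row is free or
    its vector has a larger abscissa, the new column takes the slot and the displaced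
    vector is reduced further instead ([reducing_swap], [reducing_eliminate]).
    The first displacement proves that the column lies outside the step of its own
    abscissa, and without a displacement the column is reduced to zero by vectors of
    that step ([reducing_end]), so that one pass decides the selection and restores
    the adapted basis.

    A column costs [O(m)] for the scan and [O(m)] for every occupied slot, of which
    there are at most [minn m n] ([occupied_slots]); over all columns this sums to
    [O(m * n * minn m n)], up to a constant for each column.
    The reduction works in place, so the memory consists of the input, the output,
    one slot number per row and a few registers. *)

Set Implicit Arguments.
Unset Strict Implicit.
Unset Printing Implicit Defensive.

Import Order.TTheory GRing.Theory Num.Theory.

(** * Graded components of relations *)

Section Components.
Local Open Scope ring_scope.
Variable K : fieldType.
Local Notation R := {mpoly K[2]}.

Definition mono (g z : grade) : 'X_{1..2} :=
  [multinom (if i == ord0 then `|z.1 - g.1|%N else `|z.2 - g.2|%N) | i < 2].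

(** The grade of [x^m v] for [v] of grade [g]. *)
Definition gshift (g : grade) (m : 'X_{1..2}) : grade :=
  (g.1 + (m 0)%:Z, g.2 + (m 1)%:Z).

Lemma xpowE g z : xpow K g z = 'X_[mono g z].
Proof. exact: mpolyX_mon. Qed.

Lemma mnm2P (m m' : 'X_{1..2}) : m 0 = m' 0 -> m 1 = m' 1 -> m = m'.
Proof.
move=> e0 e1; apply/mnmP => -[[|[|//]] hi].
  by rewrite (_ : Ordinal hi = 0) //; apply/val_inj.
by rewrite (_ : Ordinal hi = 1) //; apply/val_inj.
Qed.

Lemma mono0E g z : mono g z 0 = `|z.1 - g.1|%N.
Proof. by rewrite mnmE. Qed.

Lemma mono1E g z : mono g z 1 = `|z.2 - g.2|%N.
Proof. by rewrite mnmE. Qed.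

Lemma gshift_eq g m z : (gshift g m == z) = (g <= z)%O && (m == mono g z).
Proof.
apply/eqP/andP => [<-|[]]; rewrite leEprod.
  rewrite /= !lerDl; split=> //; apply/eqP/mnm2P;
  by rewrite ?mono0E ?mono1E /= addrAC subrr add0r absz_nat.
case: z => z1 z2 /andP[h1 h2] /eqP->.
by rewrite /gshift mono0E mono1E /= !gez0_abs ?subr_ge0 //= !subrKC.
Qed.

Lemma mono_refl g : mono g g = 0%MM.
Proof. by apply: mnm2P; rewrite ?mono0E ?mono1E mnmE subrr. Qed.

Lemma xpow_refl g : xpow K g g = 1.
Proof. by rewrite xpowE mono_refl mpolyX0. Qed.

Lemma xpow_trans h g z : (h <= g)%O -> (g <= z)%O ->
  xpow K g z * xpow K h g = xpow K h z.
Proof.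
rewrite !leEprod => /andP[h1 h2] /andP[g1 g2].
rewrite !xpowE -mpolyXD; congr 'X_[_]; apply: mnm2P;
rewrite mnmDE ?mono0E ?mono1E; apply: (can_inj absz_nat);
by rewrite PoszD !gez0_abs ?subr_ge0 ?(le_trans h1) ?(le_trans h2) // addrA subrK.
Qed.

Section Pieces.
Variable M : bipersModule K.
Implicit Types (z : grade) (u v : M).

Lemma pieceD z u v : piece z u -> piece z v -> piece z (u + v).
Proof. by move=> hu hv; have := bp_linear 1 hu hv; rewrite scale1r. Qed.

Lemma pieceZ z (c : K) v : piece z v -> piece z (c%:MP *: v).
Proof. by move=> hv; have := bp_linear c hv (bp_zero _ z); rewrite addr0. Qed.

Lemma piece_sum z (I : Type) (r : seq I) (P : pred I) (F : I -> M) :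
  (forall i, P i -> piece z (F i)) -> piece z (\sum_(i <- r | P i) F i).
Proof.
move=> hF; elim/big_rec: _ => [|i v Pi hv]; first exact: bp_zero.
by apply: pieceD => //; apply: hF.
Qed.

Lemma pieceX z (m : 'X_{1..2}) v : piece z v -> piece (gshift z m) ('X_[m] *: v).
Proof.
move=> hv.
have -> : 'X_[m] = 'X_0 ^+ (m 0) * 'X_1 ^+ (m 1) :> R.
  rewrite mpolyXE_id big_ord_recl big_ord1.
  by congr (_ * 'X__ ^+ (m _)); apply/val_inj.
rewrite -scalerA /gshift.
have: piece (z.1, z.2 + (m 1)%:Z) ('X_1 ^+ m 1 *: v).
  elim: (m 1) => [|k IH]; first by rewrite expr0 scale1r addr0; case: z hv.
  rewrite exprS -scalerA -addn1 PoszD addrA.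
  exact: bp_shift 1 _ IH.
set w := _ *: v; move: w => w hw.
elim: (m 0) => [|k IH]; first by rewrite expr0 scale1r addr0.
rewrite exprS -scalerA -addn1 PoszD addrA.
exact: bp_shift 0 _ IH.
Qed.

Section Coordinates.
Variables (n : nat) (B : 'I_n -> M) (gr : 'I_n -> grade).

Lemma of_coordsD z c d :
  of_coords B gr z (c + d) = of_coords B gr z c + of_coords B gr z d.
Proof. by rewrite -big_split; apply: eq_bigr => i _; rewrite mxE scalerDl scalerDl. Qed.

Lemma of_coordsZ z a c :
  of_coords B gr z (a *: c) = a%:MP *: of_coords B gr z c.
Proof.
rewrite scaler_sumr; apply: eq_bigr => i _.
by rewrite scalerA mul_mpolyC !mxE scalerA.
Qed.

Lemma of_coords0 z : of_coords B gr z 0 = 0.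
Proof. by rewrite -[X in of_coords _ _ _ X](scale0r 0) of_coordsZ scale0r. Qed.

Lemma of_coords_shift g z (c : 'cV[K]_n) : (g <= z)%O ->
  (forall i, ~~ (gr i <= g)%O -> c i 0 = 0) ->
  xpow K g z *: of_coords B gr g c = of_coords B gr z c.
Proof.
move=> gz hc; rewrite scaler_sumr [RHS]/of_coords.
rewrite [RHS](bigID (fun i => (gr i <= g)%O)) /= [X in _ + X]big1 ?addr0.
  apply: eq_big => [i|i hi]; last first.
    by rewrite scalerA -scalerAr xpow_trans.
  by case h: (gr i <= g)%O; rewrite ?andbF ?andbT // (le_trans h gz).
by move=> i /andP[_ /hc->]; rewrite !scale0r.
Qed.

(** A module is the direct sum of its pieces, so every graded component of a
    relation between homogeneous elements is again a relation; the component in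
    grade [z] picks one monomial of each coefficient. *)
Lemma relation_component (r : 'I_n -> R) z :
  (forall k, piece (gr k) (B k)) ->
  \sum_k r k *: B k = 0 ->
  of_coords B gr z (\col_k (r k)@_(mono (gr k) z)) = 0.
Proof.
move=> grB rel0.
(* The expansion of the relation into monomials, grouped by grade in [f]. *)
pose L := [seq (k, m) | k <- enum 'I_n, m <- msupp (r k)].
pose term (p : 'I_n * 'X_{1..2}) : M := ((r p.1)@_p.2 *: 'X_[p.2]) *: B p.1.
pose gp (p : 'I_n * 'X_{1..2}) : grade := gshift (gr p.1) p.2.
pose f w : M := \sum_(p <- L | gp p == w) term p.
pose zs := undup (map gp L).
have fp w : piece w (f w).
  apply: piece_sum => p /eqP<-.
  by rewrite /term -mul_mpolyC -scalerA; apply/pieceZ/pieceX.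
have sumL (P : pred ('I_n * 'X_{1..2})) : \sum_(p <- L | P p) term p =
    \sum_k \sum_(m <- msupp (r k) | P (k, m)) term (k, m).
  rewrite big_mkcond big_allpairs_dep /= big_enum.
  by apply: eq_bigr => k _; rewrite [RHS]big_mkcond.
have fz : f z = 0.
  have [zin|zout] := boolP (z \in zs); last first.
    rewrite /f big_seq_cond big1 // => p /andP[pL /eqP gpz]; case/negP: zout.
    by rewrite mem_undup -gpz map_f.
  apply: (bp_indep (zs := zs) (f := f)) => //; first exact: undup_uniq.
  rewrite (exchange_big_dep predT) //=.
  rewrite (eq_big_seq term) => [|p pL]; last first.
    rewrite -big_filter (_ : filter _ _ = [:: gp p]) ?big_seq1 //.
    rewrite (@eq_filter _ _ (pred1 (gp p))) => [|w]; last by rewrite /= eq_sym.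
    by rewrite filter_pred1_uniq ?undup_uniq // mem_undup map_f.
  rewrite sumL -[RHS]rel0; apply: eq_bigr => k _.
  by rewrite [in RHS](mpolyE (r k)) scaler_suml.
rewrite -[RHS]fz /f sumL /of_coords [RHS](bigID (fun k => (gr k <= z)%O)) /=.
rewrite [X in _ + X]big1 ?addr0 => [|k /negPf nk]; last first.
  by rewrite big1 // => m; rewrite gshift_eq nk.
apply: eq_bigr => k hk; rewrite mxE xpowE.
under [RHS]eq_bigl => m do rewrite gshift_eq hk /=.
rewrite -big_filter.
have [inS|outS] := boolP (mono (gr k) z \in msupp (r k)).
  by rewrite filter_pred1_uniq ?msupp_uniq // big_seq1.
rewrite (memN_msupp_eq0 outS) !scale0r big_filter big_seq_cond big1 // => m.
by case/andP=> mS /eqP mE; move: outS; rewrite -mE mS.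
Qed.

End Coordinates.
End Pieces.
End Components.

(** * Minimal generators of a free module are independent *)

Section Independence.
Local Open Scope ring_scope.
Variable K : fieldType.
Local Notation R := {mpoly K[2]}.

Section Spans.
Variable M : bipersModule K.
Implicit Types (S : M -> Prop) (u v : M).

Lemma mspan_mem S v : S v -> mspan S v.
Proof.
move=> Sv; exists [:: (1, v)]; rewrite big_seq1 scale1r; split=> // p.
by rewrite inE => /eqP->.
Qed.

Lemma mspanD S u v : mspan S u -> mspan S v -> mspan S (u + v).
Proof.
move=> [l [lS ->]] [l' [lS' ->]]; exists (l ++ l'); rewrite big_cat; split=> // p.
by rewrite mem_cat => /orP[/lS|/lS'].
Qed.

Lemma mspanZ S (r : R) v : mspan S v -> mspan S (r *: v).
Proof.
move=> [l [lS ->]]; exists [seq (r * p.1, p.2) | p <- l]; split.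
  by move=> _ /mapP[p /lS ? ->].
by rewrite big_map scaler_sumr; apply: eq_bigr => p _; rewrite scalerA.
Qed.

Lemma mspan0 S : mspan S 0.
Proof. by exists [::]; rewrite big_nil. Qed.

Lemma mspan_sum S (I : eqType) (r : seq I) (P : pred I) (F : I -> M) :
  (forall i, i \in r -> P i -> mspan S (F i)) -> mspan S (\sum_(i <- r | P i) F i).
Proof.
move=> hF; rewrite big_seq_cond; elim/big_rec: _ => [|i v /andP[ri Pi] hv].
  exact: mspan0.
by apply: mspanD => //; apply: hF.
Qed.

Lemma mspan_trans S S' v : (forall u, S u -> mspan S' u) -> mspan S v -> mspan S' v.
Proof.
move=> SS' [l [lS ->]]; apply: mspan_sum => p /lS Sp _.
by apply/mspanZ/SS'.
Qed.

Lemma mspan_famP (I : finType) (P : pred I) (w : I -> M) v :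
  mspan (fun u => exists2 i, P i & u = w i) v <->
  exists r : I -> R, v = \sum_(i | P i) r i *: w i.
Proof.
split=> [[l [lS ->]]|[r ->]]; last first.
  by apply: mspan_sum => i _ Pi; apply/mspanZ/mspan_mem; exists i.
elim: l lS => [|p l IH] lS.
  by exists (fun=> 0); rewrite big_nil big1 // => i _; rewrite scale0r.
have [|r rE] := IH; first by move=> q ql; apply: lS; rewrite inE ql orbT.
have [i Pi pi] := lS p (mem_head _ _).
exists (fun k => r k + (if k == i then p.1 else 0)).
rewrite big_cons rE pi addrC; under [RHS]eq_bigr do rewrite scalerDl.
rewrite big_split /=; congr (_ + _).
by rewrite (bigD1 i) //= eqxx big1 ?addr0 // => k /andP[_ /negPf->]; rewrite scale0r.
Qed.

Section Basis.
Variables (n : nat) (B : 'I_n -> M) (gr : 'I_n -> grade).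
Hypothesis basB : ordered_basis B gr.

Lemma basis_piece k : piece (gr k) (B k).
Proof. by case: basB. Qed.

Lemma basis_span v : exists r : 'I_n -> R, v = \sum_k r k *: B k.
Proof.
have [_ _ [_ gen _]] := basB.
apply/(mspan_famP xpredT); apply: mspan_trans ((gen v).2 I) => u [i ->].
by apply: mspan_mem; exists i.
Qed.

(** Otherwise the component of the relation in the grade of [B j] would express
    [B j] through the other elements. *)
Lemma basis_relation_const (r : 'I_n -> R) :
  \sum_k r k *: B k = 0 -> forall j, (r j)@_0 = 0.
Proof.
move=> rel0 j; apply/eqP/negP => /negP nz.
have [injB _ [_ gen minB]] := basB.
pose S' u := exists2 k, k != j & u = B k.
have Bj : mspan S' (B j).
  have := relation_component (gr j) basis_piece rel0.
  rewrite /of_coords (bigD1 j) //= mxE mono_refl xpow_refl.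
  move/eqP; rewrite addr_eq0 => /eqP/(congr1 (fun u => ((r j)@_0)^-1%:MP *: u)).
  rewrite /= scalerA mul_mpolyC scalerA mulVf // !scale1r => ->.
  rewrite -sumrN; apply/mspanZ/mspan_sum => k _ /andP[_ kj].
  by rewrite -scaleNr; apply/mspanZ/mspan_mem; exists k.
have [|||k] := minB S' _ _ (B j); first by move=> _ [k _ ->]; exists k.
- move=> v; split=> // _; apply: mspan_trans ((gen v).2 I) => _ [k ->].
  by have [->//|kj] := eqVneq k j; apply: mspan_mem; exists k.
- by exists j.
- by move=> /eqP kj /injB/esym.
Qed.

(** Expressing [B] through a free basis and that one back through [B] yields a
    square matrix [T] with [B = T B].  Minimality of [B] makes [T] the identity
    modulo the ideal of [x1] and [x2], so that its determinant is a nonzero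
    polynomial.  A relation between the elements of [B] vanishes once it is
    rewritten in the free basis, hence is killed by [T]. *)
Lemma basis_indep : free_module M ->
  forall r : 'I_n -> R, \sum_k r k *: B k = 0 -> forall k, r k = 0.
Proof.
move=> [I [g [f [h [fK _]]]]] r rel0.
pose D := flatten [seq dom (f (B k)) | k <- enum 'I_n].
pose e (a : I) : M := h << a >>.
(* Only the finitely many free generators in [D] occur in the elements of [B]. *)
have [P PE] : exists P : I -> 'I_n -> R,
    forall a, a \in D -> e a = \sum_i P a i *: B i.
  elim: D => [|a D [P PE]]; first by exists (fun _ _ => 0).
  have [q qE] := basis_span (e a).
  exists (fun b => if b == a then q else P b) => b; rewrite inE.
  by case: eqP => [->|_] //= /PE.
have BE k : B k = \sum_(a <- undup D) coeff a (f (B k)) *: e a.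
  rewrite -[LHS]fK -[in LHS](freeg_sumE (f (B k))) linear_sum /=.
  pose F a := coeff a (f (B k)) *: e a.
  rewrite (eq_bigr F) => [|a _]; last first.
    rewrite /F /e -linearZ /=; congr (h _); apply/eqP/freeg_eqP => b.
    by rewrite coeffZ !coeffU mul1r.
  rewrite [RHS](bigID (mem (dom (f (B k))))) /= [X in _ + X]big1 ?addr0.
    rewrite -[RHS]big_filter; apply: perm_big; apply: uniq_perm.
    - exact: uniq_dom.
    - by rewrite filter_uniq // undup_uniq.
    move=> a; rewrite mem_filter mem_undup; case: (boolP (a \in dom _)) => //= aD.
    by apply/esym/flatten_mapP; exists k; rewrite ?mem_enum.
  by move=> a /coeff_outdom->; rewrite scale0r.
pose T := \matrix_(j, i) \sum_(a <- undup D) coeff a (f (B j)) * P a i.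
have TE j : B j = \sum_i T j i *: B i.
  rewrite {1}BE; under [RHS]eq_bigr do rewrite mxE scaler_suml.
  rewrite exchange_big; apply: eq_big_seq => a; rewrite mem_undup => /PE->.
  by rewrite scaler_sumr; apply: eq_bigr => i _; rewrite scalerA.
have T0 j i : (T j i)@_0 = (j == i)%:R.
  have: \sum_i (T j i - (i == j)%:R) *: B i = 0.
    under eq_bigr do rewrite scalerBl.
    rewrite sumrB -TE (bigD1 j) //= eqxx scale1r big1 ?addr0 ?subrr //.
    by move=> k /negPf->; rewrite scale0r.
  move/basis_relation_const/(_ i)/eqP; rewrite raddfB subr_eq0 => /eqP->.
  by rewrite eq_sym; case: eqP => _ /=; rewrite ?mcoeff0 ?mcoeff1 ?eqxx.
have detT : \det T != 0.
  apply/eqP => /(congr1 (mcoeff 0%MM)).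
  rewrite -[LHS]/((mcoeff 0%MM : {rmorphism R -> K}) _) -det_map_mx.
  rewrite (_ : map_mx _ _ = 1%:M) ?det1 ?mcoeff0; last first.
    by apply/matrixP => j i; rewrite [RHS]mxE -T0 [LHS]mxE.
  by move/eqP; rewrite oner_eq0.
have relf a : \sum_k r k * coeff a (f (B k)) = 0.
  transitivity (coeff a (f (\sum_k r k *: B k))); last by rewrite rel0 linear0 coeff0.
  rewrite [f _]linear_sum raddf_sum; apply: eq_bigr => k _.
  by rewrite -coeffZ -linearZ.
have rT : (\row_k r k) *m T = 0.
  apply/rowP => i; rewrite !mxE.
  under eq_bigr do rewrite !mxE mulr_sumr.
  rewrite exchange_big big1_seq // => a _.
  by under eq_bigr do rewrite mulrA; rewrite -mulr_suml relf mul0r.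
move=> k; have := congr1 (fun A => (A *m \adj T) 0 k) rT.
rewrite -mulmxA mul_mx_adj mul0mx mul_mx_scalar !mxE => /eqP.
by rewrite mulf_eq0 (negPf detT) => /eqP.
Qed.

Lemma of_coords_inj z (c d : 'cV[K]_n) : free_module M ->
  (forall i, ~~ (gr i <= z)%O -> c i 0 = 0) ->
  (forall i, ~~ (gr i <= z)%O -> d i 0 = 0) ->
  of_coords B gr z c = of_coords B gr z d -> c = d.
Proof.
move=> freeM hc hd cd; apply/colP => i.
have [hi|hi] := boolP (gr i <= z)%O; last by rewrite hc ?hd.
pose r k := if (gr k <= z)%O then (c - d) k 0 *: xpow K (gr k) z else 0.
have: \sum_k r k *: B k = 0.
  have: of_coords B gr z (c - d) = 0.
    by rewrite of_coordsD // -scaleN1r of_coordsZ // cd mpolyCN scaleN1r subrr.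
  rewrite /of_coords => E; rewrite -[RHS]E [RHS]big_mkcond.
  by apply: eq_bigr => k _; rewrite /r; case: ifP => // _; rewrite scale0r.
move/(basis_indep freeM)/(_ i)/(congr1 (mcoeff (mono (gr i) z))).
rewrite /r hi xpowE mcoeffZ mcoeffX eqxx mulr1 mcoeff0 !mxE.
by move/eqP; rewrite subr_eq0 => /eqP.
Qed.

End Basis.
End Spans.
End Independence.

(** * The selected columns generate the image minimally *)

Section Selection.
Local Open Scope ring_scope.
Variable K : fieldType.
Local Notation R := {mpoly K[2]}.

Lemma of_coords_sum (M : bipersModule K) n (B : 'I_n -> M) gr z (I : finType)
    (P : pred I) (c : I -> 'cV[K]_n) :
  of_coords B gr z (\sum_(i | P i) c i) = \sum_(i | P i) of_coords B gr z (c i).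
Proof.
apply: (big_morph (of_coords B gr z)); [exact: of_coordsD|exact: of_coords0].
Qed.

Lemma colex_snd g z : colex_le g z -> (g.2 <= z.2)%R.
Proof. by rewrite /colex_le lexi_pair => /andP[]. Qed.

Lemma colex_anti g z : colex_le g z -> (z <= g)%O -> g = z.
Proof.
rewrite /colex_le lexi_pair leEprod /= => /andP[h2 /implyP h1] /andP[h1' h2'].
case: g z h1 h2 h1' h2' => [g1 g2] [z1 z2] /= h1 h2 h1' h2'.
by congr (_, _); apply/eqP; rewrite eq_le ?h2 ?h1' ?h1.
Qed.

Section Columns.
Variables (m n : nat) (A : bigradedMatrix K m n).

Definition col_sel (j : 'I_n) : bool :=
  col j A \notin (\sum_(i < n | ((i < j)%N && ((bg_label A i).1 <= (bg_label A j).1)%R))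
                     <[col i A]>)%VS.

Definition selected_columns : seq ('cV[K]_m * grade) :=
  [seq (col j A, bg_label A j) | j <- enum 'I_n & col_sel j].

Variables (F F' : bipersModule K) (gamma : bipersMorphism F F').
Variables (B : 'I_n -> F) (gr : 'I_n -> grade).
Variables (B' : 'I_m -> F') (gr' : 'I_m -> grade).
Hypotheses (freeF' : free_module F') (basB : ordered_basis B gr).
Hypotheses (basB' : ordered_basis B' gr') (repA : represents A gamma B gr B' gr').

Let w j : F' := gamma (B j).
Let lab j : bg_label A j = gr j. Proof. by case: (repA j). Qed.
Let wE j : w j = of_coords B' gr' (gr j) (col j A).
Proof. by case: (repA j) => _ []. Qed.
Let colS j i : ~~ (gr' i <= gr j)%O -> col j A i 0 = 0.
Proof. by case: (repA j) => _ [+ _]; apply. Qed.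
Let w_piece j : piece (gr j) (w j).
Proof. by apply: bp_fun_piece; apply: basis_piece basB j. Qed.

Let of_coords_w z (c : 'cV[K]_n) :
  of_coords w gr z c =
  of_coords B' gr' z (\sum_(k | (gr k <= z)%O) c k 0 *: col k A).
Proof.
rewrite of_coords_sum; apply: eq_bigr => k kz.
rewrite of_coordsZ -mul_mpolyC -scalerA; congr (_ *: _).
by rewrite wE of_coords_shift //; apply: colS.
Qed.

(** By induction on [j]: a relation expressing an unselected column by earlier
    columns of smaller or equal grade lifts to the module, after
    multiplication by monomials. *)
Lemma sel_generates j : mspan (fun u => exists2 k, col_sel k & u = w k) (w j).
Proof.
have [N] := ubnP (j : nat); elim: N j => // N IH j jN.
have [sj|] := boolP (col_sel j); first by apply: mspan_mem; exists j.
rewrite negbK => /memv_sumP[vs vsP jE].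
rewrite wE jE of_coords_sum; apply: mspan_sum => i _ /andP[ij xij].
have /vlineP[a ->] := vsP i (introT andP (conj ij xij)).
rewrite of_coordsZ -(@of_coords_shift _ _ _ _ _ (gr i)) -?wE.
- by apply/mspanZ/mspanZ/IH; apply: leq_trans ij _; rewrite -ltnS.
- rewrite leEprod -!lab xij; apply: colex_snd.
  by apply: bg_sorted; apply: ltnW.
- exact: colS.
Qed.

(** In the grade of [w j], a relation of [w j] to other selected images is a
    linear relation between columns.  Its last column lies in the span of
    earlier columns of smaller or equal grade: it is column [j] itself, or a
    column after [j] in the colexicographical order whose grade is bounded by,
    hence equal to, that of [j]. *)
Lemma sel_irredundant j : col_sel j ->
  ~ mspan (fun u => exists2 k, col_sel k && (k != j) & u = w k) (w j).
Proof.
move=> sj /(mspan_famP (fun k => col_sel k && (k != j)))[r rE].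
pose r' k : R := if k == j then 1 else if col_sel k then - r k else 0.
have rel0 : \sum_k r' k *: w k = 0.
  rewrite (bigD1 j) //= /r' eqxx scale1r {1}rE.
  rewrite [X in _ + X](bigID col_sel) /= [X in _ + (_ + X)]big1 ?addr0.
    rewrite (eq_bigl (fun k => (k != j) && col_sel k)) => [|k]; last exact: andbC.
    rewrite -big_split big1 //= => k /andP[/negPf-> ->].
    by rewrite /= scaleNr subrr.
  by move=> k /andP[/negPf-> /negPf->]; rewrite scale0r.
have := relation_component (gr j) w_piece rel0.
set c := \col_k _ => cw.
have cj : c j 0 = 1 by rewrite mxE /r' eqxx mono_refl mcoeff1 eqxx.
have csel k : c k 0 != 0 -> col_sel k.
  rewrite mxE /r'; have [->|_] := eqVneq k j; first by []; case: ifP => // _.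
  by rewrite mcoeff0 eqxx.
have c0 : \sum_(k | (gr k <= gr j)%O) c k 0 *: col k A = 0.
  apply: (of_coords_inj (z := gr j) basB' freeF').
  - move=> i hi; rewrite summxE big1 // => k kj.
    by rewrite mxE colS ?mulr0 //; apply: contra hi => /le_trans; apply.
  - by move=> i _; rewrite mxE.
  - by rewrite -of_coords_w cw of_coords0.
have Pj : (gr j <= gr j)%O && (c j 0 != 0) by rewrite lexx cj oner_eq0.
(* [l] is the last column of the relation. *)
have [l /andP[lj cl] lmax] :=
  @arg_maxnP _ j (fun k => (gr k <= gr j)%O && (c k 0 != 0)) (fun k => k : nat) Pj.
have jl : gr l = gr j.
  rewrite -!lab; apply/esym/colex_anti; last by rewrite !lab.
  by apply: bg_sorted; apply: lmax.
have /negP := csel _ cl; apply.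
have -> : col l A =
    - (c l 0)^-1 *: \sum_(k | (gr k <= gr j)%O && (k != l)) c k 0 *: col k A.
  move/eqP: c0; rewrite (bigD1 l) //= addr_eq0 => /eqP E.
  by rewrite scaleNr -scalerN -E scalerA mulVf // scale1r.
apply/memvZ/rpred_sum => k /andP[kj kl].
have [->|ck] := eqVneq (c k 0) 0; first by rewrite scale0r mem0v.
have kl' : (k < l)%N.
  by rewrite ltn_neqAle kl; apply: lmax; rewrite kj.
apply/memvZ; apply: (subvP (sumv_sup k _ (subvv _))); last exact: memv_line.
rewrite kl' !lab jl; by move: kj; rewrite leEprod => /andP[].
Qed.

(** A subset of the selected images that still generates must contain each of
    them: a combination for [w j] that avoids [w j] contradicts
    [sel_irredundant], which also makes the selected images distinct. *)
Lemma selected_columns_minimal :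
  lists_minimal_generators gamma B' gr' selected_columns.
Proof.
have mapE : [seq of_coords B' gr' p.2 p.1 | p <- selected_columns] =
            [seq w j | j <- enum 'I_n & col_sel j].
  by rewrite -map_comp; apply: eq_map => j /=; rewrite wE lab.
have memE u : u \in [seq w j | j <- enum 'I_n & col_sel j] <->
              exists2 j, col_sel j & u = w j.
  split=> [/mapP[j]|[j sj ->]]; last by rewrite map_f // mem_filter sj mem_enum.
  by rewrite mem_filter => /andP[sj _] ->; exists j.
have gen : generates (fun u => u \in [seq w j | j <- enum 'I_n & col_sel j])
                     (Defs.image gamma).
  move=> u; split=> [[l [lS ->]]|[v ->]].
    elim: l lS => [|p l IH] lS; first by exists 0; rewrite linear0 big_nil.
    have [|v vE] := IH; first by move=> q ql; apply: lS; rewrite inE ql orbT.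
    have /memE[j _ pj] := lS _ (mem_head p l).
    by exists (p.1 *: B j + v); rewrite big_cons vE pj linearD linearZ.
  have [r ->] := basis_span basB v; rewrite linear_sum.
  apply: mspan_sum => j _ _; rewrite linearZ; apply/mspanZ.
  by apply: mspan_trans (sel_generates j) => x /memE; apply: mspan_mem.
split.
- move=> p /mapP[j _ ->] /=; split=> //.
  by rewrite lab; apply: colS.
- rewrite mapE map_inj_in_uniq; first by apply: filter_uniq; apply: enum_uniq.
  move=> i j.
  rewrite !mem_filter => /andP[si _] /andP[sj _] wij.
  apply/eqP/negP => /negP ij; apply: (sel_irredundant sj).
  by apply: mspan_mem; exists i; rewrite ?si.
rewrite mapE; split=> //.
  by move=> u /memE[j _ ->]; exists (gr j).
move=> S' S'S genS' u /memE[j sj uj].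
suff [l [lS jE]] : mspan (fun x => S' x) (w j).
  have [S'j|] := boolP (has (fun p => p.2 == w j) l).
    by move/hasP: S'j => [p /lS Sp /eqP pj]; rewrite uj -pj.
  move/hasPn => nS; case: (sel_irredundant sj).
  exists l; split=> // p pl.
  have /memE[k sk pk] := S'S _ (lS _ pl).
  exists k => //; rewrite sk; apply: contra (nS _ pl) => /eqP <-.
  by rewrite pk.
by apply/genS'; exists (B j).
Qed.

End Columns.
End Selection.

(** * Echelon bases adapted to a filtration *)

Section FilteredEchelon.
Local Open Scope ring_scope.
Variables (K : fieldType) (m : nat).
Implicit Types (W v : nat -> 'cV[K]_m) (sl : nat -> nat) (x : nat -> int).

Definition leads (k : 'I_m) (w : 'cV[K]_m) : Prop :=
  w k 0 != 0 /\ forall k' : 'I_m, (k' < k)%N -> w k' 0 = 0.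

(** Leading rows are distinct, hence the leading row of a combination is that of
    one of the vectors that take part in it. *)
Lemma echelon_lead (w : 'I_m -> 'cV[K]_m) (P : pred 'I_m) u (i : 'I_m) :
  (forall k, w k = 0 \/ leads k (w k)) ->
  u \in (\sum_(k | P k) <[w k]>)%VS -> leads i u -> P i && (w i i 0 != 0).
Proof.
move=> ech /memv_sumP[us usP]; rewrite big_mkcond /=.
pose y (k : 'I_m) := if P k then us k else 0.
rewrite -[\sum_k _]/(\sum_k y k) => uE [ui ulow].
have yE k : exists a, y k = a *: w k.
  rewrite /y; case: ifP => [/usP/vlineP//|_]; by exists 0; rewrite scale0r.
have ykk (k : 'I_m) : (forall l : 'I_m, (l < k)%N -> y l = 0) -> u k 0 = y k k 0.
  move=> y0; rewrite uE summxE (bigD1 k) //= big1 ?addr0 // => l lk.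
  have [kl|lk'] := ltnP k l; last by rewrite y0 ?mxE // ltn_neqAle lk.
  have [a ->] := yE l; rewrite mxE.
  by have [->|[_ ->]] := ech l; rewrite ?mxE ?mulr0.
(* No vector with a leading row above [i] takes part. *)
have y0 (k : 'I_m) : (k < i)%N -> y k = 0.
  have [N] := ubnP (k : nat); elim: N k => // N IH k kN ki.
  have := ykk k (fun l lk => IH l (leq_trans lk kN) (ltn_trans lk ki)).
  rewrite ulow //; have [a ->] := yE k; rewrite mxE.
  have [->|[wk _]] := ech k; first by rewrite scaler0.
  by move/esym/eqP; rewrite mulf_eq0 (negPf wk) orbF => /eqP->; rewrite scale0r.
move: ui; rewrite (ykk i y0); have [a] := yE i; rewrite /y.
case: (P i) => [-> /=|_]; last by rewrite mxE eqxx.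
by rewrite mxE; apply: contraNneq => ->; rewrite mulr0.
Qed.

Section Reduction.
Variables (n : nat) (v : nat -> 'cV[K]_m) (x : nat -> int).

Definition prefix_span j t : {vspace 'cV[K]_m} :=
  (\sum_(c < j | (x c <= t)%R) <[v c]>)%VS.

Definition slot_span W sl t : {vspace 'cV[K]_m} :=
  (\sum_(k < m | (x (sl k) <= t)%R) <[W (sl k)]>)%VS.

Definition new_col j : bool := v j \notin prefix_span j (x j).

Definition line_upto W c t : {vspace 'cV[K]_m} :=
  (if (x c <= t)%R then <[W c]> else 0)%VS.

(** The column number [n], where the zero vector is stored, marks an empty
    slot. *)
Definition slots_ok W sl j : Prop :=
  forall k : 'I_m, sl k = n \/ (sl k < j)%N /\ leads k (W (sl k)).

(** The state between two columns: [W] holds the current columns and [sl] the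
    number of the column with a given leading row. *)
Record reduced W sl j : Prop := Reduced {
  red_slots : slots_ok W sl j;
  red_span : forall t, slot_span W sl t = prefix_span j t;
  red_rest : forall c, (j <= c)%N -> W c = v c
}.

(** The state within the reduction of column [j], when the rows above [i] are
    done.  The column [cur] is still to be reduced; it is column [j] until a first
    displacement, and the zero column [n] once an empty slot has been taken.
    The working column completes the slots to the span that includes column [j],
    whence a column that is reduced to zero leaves an adapted basis behind. *)
Record reducing W sl j i cur (found : bool) : Prop := Reducing {
  ing_slots : slots_ok W sl j.+1;
  ing_cur : cur = n \/ (cur <= j)%N /\ forall k : 'I_m, sl k <> cur;
  ing_low : forall k : 'I_m, (k < i)%N -> W cur k 0 = 0;
  ing_span : forall t,
    (slot_span W sl t + line_upto W cur t)%VS = prefix_span j.+1 t;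
  ing_found : if found then is_true (new_col j)
              else cur = j /\ forall t, slot_span W sl t = prefix_span j t;
  ing_rest : forall c, (j < c)%N -> W c = v c
}.

Lemma prefix_spanS j t :
  prefix_span j.+1 t = (prefix_span j t + line_upto v j t)%VS.
Proof. by rewrite /prefix_span big_mkcond big_ord_recr /= -big_mkcond. Qed.

Lemma slot_spanD1 W sl t (i : 'I_m) : slot_span W sl t =
  (line_upto W (sl i) t +
   \sum_(k < m | (k != i) && (x (sl k) <= t)%R) <[W (sl k)]>)%VS.
Proof.
rewrite /slot_span big_mkcond (bigD1 i) //= -/(line_upto W (sl i) t).
by rewrite -big_mkcondr.
Qed.

Lemma eq_slot_span W W' sl sl' t :
  W' =1 W -> sl' =1 sl -> slot_span W' sl' t = slot_span W sl t.
Proof.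
by move=> eW esl; rewrite /slot_span; apply: eq_big => k; rewrite esl // eW.
Qed.

Lemma eq_reduced W W' sl sl' j :
  W' =1 W -> sl' =1 sl -> reduced W sl j -> reduced W' sl' j.
Proof.
move=> eW esl [slots span rest]; split=> [k|t|c jc].
- by rewrite esl eW.
- by rewrite (eq_slot_span _ eW esl).
- by rewrite eW rest.
Qed.

Lemma eq_line_upto W W' c t : W' c = W c -> line_upto W' c t = line_upto W c t.
Proof. by rewrite /line_upto => ->. Qed.

Hypothesis vn : v n = 0.
Variable j : nat.
Hypothesis jn : (j < n)%N.

Lemma reducing_start W sl : reduced W sl j -> reducing W sl j 0 j false.
Proof.
case=> slots span rest; split=> //.
- by move=> k; have [->|[kj ?]] := slots k; [left|right; rewrite ltnW].
- right; split=> // k kj; have [E|[+ _]] := slots k.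
    by move: jn; rewrite -kj E ltnn.
  by rewrite kj ltnn.
- by move=> t; rewrite prefix_spanS span (@eq_line_upto v) // rest.
- by move=> c /ltnW/rest.
Qed.

Lemma reducing_zero W sl i cur found : reducing W sl j i cur found -> W n = 0.
Proof. by case=> _ _ _ _ _ rest; rewrite rest. Qed.

Lemma slots_lead W sl j' : W n = 0 -> slots_ok W sl j' ->
  forall k : 'I_m, W (sl k) = 0 \/ leads k (W (sl k)).
Proof. by move=> Wn slots k; have [->|[_ ?]] := slots k; [left|right]. Qed.

(** Exchanging the working column with the content of slot [i] preserves the
    spans.  If this is the first displacement, the slots of abscissa at most
    [x j] span the same as the columns before [j] with this bound, but by
    [echelon_lead] they do not span the working column, since none of them has
    leading row [i]. *)
Lemma reducing_swap W sl (i : 'I_m) cur found sl' :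
  reducing W sl j i cur found -> W cur i 0 != 0 ->
  (W (sl i) i 0 == 0) || (x cur < x (sl i))%R ->
  (forall k, sl' k = if k == i then cur else sl k) ->
  reducing W sl' j i (sl i) true.
Proof.
move=> inv Wi cond sl'E; have Wn := reducing_zero inv.
have [slots cur_ok low span found_ok rest] := inv.
have ech := slots_lead Wn slots.
have curj : (cur <= j)%N /\ forall k : 'I_m, sl k <> cur.
  by case: cur_ok Wi => // ->; rewrite Wn mxE eqxx.
have sl'i : sl' i = cur by rewrite sl'E eqxx.
have sl'N (k : 'I_m) : k != i -> sl' k = sl k by rewrite sl'E -val_eqE => /negPf->.
split=> //.
- move=> k; have [->|ki] := eqVneq k i; last by rewrite sl'N.
  right; rewrite sl'i ltnS; split; first by case: curj.
  by split.
- have [->|[ij [Wii Wilow]]] := slots i; first by left.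
  right; split=> [|k]; first by rewrite -ltnS.
  have [->|ki] := eqVneq k i.
    by rewrite sl'i => /esym e; case: curj => _ /(_ i)/(_ e).
  rewrite sl'N // => E; have [kn|[_ [+ klow]]] := slots k.
    by move: Wii; rewrite -E kn Wn mxE eqxx.
  have [ik|] := ltnP i k; first by move: Wii; rewrite -E klow ?eqxx.
  rewrite leq_eqVlt val_eqE (negPf ki) /= => ki'.
  by rewrite E Wilow ?eqxx.
- by move=> k ki; have [->|[_ ->]] := ech i; rewrite ?mxE.
- move=> t; rewrite -span (slot_spanD1 W sl' t i) (slot_spanD1 W sl t i) sl'i.
  rewrite (eq_bigr (fun k : 'I_m => <[W (sl k)]>%VS)); last first.
    by move=> k /andP[/sl'N->].
  rewrite (eq_bigl (fun k : 'I_m => (k != i) && (x (sl k) <= t)%R)); last first.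
    by move=> k /=; case: eqVneq => //= /sl'N->.
  by rewrite -addvA [RHS]addvC; congr (_ + _)%VS; rewrite addvC.
- case: found {inv} found_ok => // -[curE span0].
  apply/negP => vin; have: W cur \in slot_span W sl (x j).
    rewrite span0 -(_ : prefix_span j.+1 (x j) = prefix_span j (x j)).
      by rewrite -span memvE (subv_trans _ (addvSr _ _)) // /line_upto curE lexx.
    by rewrite prefix_spanS /line_upto lexx; apply/addv_idPl; rewrite -memvE.
  move/(echelon_lead ech)/(_ (conj Wi low)) => /andP[xi Wii].
  by move: cond; rewrite (negPf Wii) /= curE ltNge xi.
Qed.

(** Subtracting a vector of smaller or equal abscissa does not change any step
    of the filtration. *)
Lemma reducing_eliminate W sl (i : 'I_m) cur found W' :
  reducing W sl j i cur found ->
  W cur i 0 != 0 -> W (sl i) i 0 != 0 -> (x (sl i) <= x cur)%R ->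
  (forall c, W' c = if c == cur then
                      W cur - (W cur i 0 / W (sl i) i 0) *: W (sl i)
                    else W c) ->
  reducing W' sl j i.+1 cur found.
Proof.
move=> inv Wi Wii xi W'E; have Wn := reducing_zero inv.
have [slots cur_ok low span found_ok rest] := inv.
have [curj curN] : (cur <= j)%N /\ forall k : 'I_m, sl k <> cur.
  by case: cur_ok Wi => // ->; rewrite Wn mxE eqxx.
have W'sl (k : 'I_m) : W' (sl k) = W (sl k) by rewrite W'E; case: eqP => // /curN.
have spanE t : slot_span W' sl t = slot_span W sl t.
  by apply: eq_bigr => k _; rewrite W'sl.
have ilow (k : 'I_m) : (k < i)%N -> W (sl i) k 0 = 0.
  by have [E|[_ [_]]] := slots i; [move: Wii; rewrite E Wn mxE eqxx|apply].
split=> //.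
- by move=> k; rewrite W'sl.
- move=> k; rewrite ltnS W'E eqxx !mxE leq_eqVlt val_eqE => /orP[/eqP->|ki].
    by rewrite divfK // subrr.
  by rewrite (low k ki) (ilow k ki) mulr0 subr0.
- move=> t; rewrite spanE -span /line_upto; case: ifP => // xt.
  set a := W cur i 0 / _ in W'E *.
  have xit : W (sl i) \in slot_span W sl t.
    apply: (subvP (sumv_sup i _ (subvv _))); last exact: memv_line.
    exact: le_trans xi xt.
  apply/eqP; rewrite eqEsubv !subv_add !addvSl /= -!memvE W'E eqxx.
  apply/andP; split.
    by rewrite addrC memv_add ?memv_line // -scaleNr memvZ.
  by rewrite -[X in X \in _](subrK (a *: W (sl i))) addrC memv_add ?memv_line // memvZ.
- by case: found {inv} found_ok => // -[? h]; split=> // t; rewrite spanE.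
- by move=> c jc; rewrite W'E; case: eqP jc => [->|_ /rest//]; rewrite ltnNge curj.
Qed.

Lemma reducing_skip W sl (i : 'I_m) cur found : W cur i 0 = 0 ->
  reducing W sl j i cur found -> reducing W sl j i.+1 cur found.
Proof.
move=> Wi [? ? low ? ? ?]; split=> // k; rewrite ltnS leq_eqVlt val_eqE.
by case/orP=> [/eqP->|/low].
Qed.

(** Without a displacement, the span up to [x j] is the same before and after
    column [j], which therefore lies in it. *)
Lemma reducing_end W sl cur found : reducing W sl j m cur found ->
  reduced W sl j.+1 /\ found = new_col j.
Proof.
case=> slots _ low span found_ok rest.
have W0 : W cur = 0 by apply/colP => k; rewrite low ?mxE.
have {}span t : slot_span W sl t = prefix_span j.+1 t.
  rewrite -span /line_upto W0; case: ifP => _; last by rewrite addv0.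
  by apply/esym/addv_idPl; rewrite -memvE mem0v.
split; first by split.
case: found found_ok => [->//|[_ spanj]].
apply/esym/negbTE; rewrite negbK -spanj span prefix_spanS /line_upto lexx.
by rewrite memvE addvSr.
Qed.

Lemma eq_reducing W W' sl sl' i cur found :
  W' =1 W -> sl' =1 sl -> reducing W sl j i cur found -> reducing W' sl' j i cur found.
Proof.
move=> eW esl [slots cur_ok low span found_ok rest].
have spanE t := eq_slot_span t eW esl.
split.
- by move=> k; rewrite esl eW.
- by case: cur_ok => [?|[? h]]; [left|right; split=> // k; rewrite esl].
- by move=> k; rewrite eW; apply: low.
- by move=> t; rewrite spanE (@eq_line_upto W).
- by case: found found_ok => // -[? h]; split=> // t; rewrite spanE.
- by move=> c; rewrite eW; apply: rest.
Qed.

End Reduction.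

(** Distinct occupied slots hold distinct columns, as these have distinct leading
    rows. *)
Lemma occupied_slots n v x W sl j : v n = 0 -> (j <= n)%N -> reduced n v x W sl j ->
  (\sum_(k < m) (sl k != n) <= minn m j)%N.
Proof.
move=> vn jn [slots _ _]; rewrite leq_min; apply/andP; split.
  rewrite -[X in (_ <= X)%N]card_ord -sum1_card; apply: leq_sum => k _.
  exact: leq_b1.
pose s := map (fun k : 'I_m => sl k) [seq k <- enum 'I_m | sl (k : 'I_m) != n].
have -> : (\sum_(k < m) (sl k != n) = size s)%N.
  rewrite size_map size_filter -sumn_count sumnE big_map big_enum.
  by apply: eq_bigr.
rewrite -(size_iota 0 j); apply: uniq_leq_size; last first.
  move=> c /mapP[k]; rewrite mem_filter mem_iota => /andP[/eqP kn _] ->.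
  by have [/kn|[]] := slots k.
rewrite map_inj_in_uniq; first by apply: filter_uniq; apply: enum_uniq.
move=> k l; rewrite !mem_filter => /andP[/eqP kn _] /andP[/eqP ln _] kl.
have [/kn//|[_ [Wk klow]]] := slots k; have [/ln//|[_ [Wl llow]]] := slots l.
apply: val_inj; have [lt|lt|//] := ltngtP (k : nat) l.
  by move: Wk; rewrite kl llow ?eqxx.
by move: Wl; rewrite -kl klow ?eqxx.
Qed.

End FilteredEchelon.

(** * The program *)

Local Open Scope nat_scope.

Section Program.

Definition reg a := IRead a (IConst 0) (IConst 0).
(** The number of rows for [b = 0] and of columns for [b = 1]. *)
Definition extent b := IRead 0 (IConst 0) (IConst b).
Definition set_reg a e := SetIdx a (IConst 0) (IConst 0) e.

Definition for_ a b body :=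
  Seq (set_reg a (IConst 0))
    (While (BIdxLe (ISucc (reg a)) (extent b))
       (Seq body (set_reg a (ISucc (reg a))))).

(** Names of the index arrays.  Apart from [a_slot], which has one cell per row,
    they are used as single registers. *)
Definition r_count := 1.
Definition r_col := 2.
Definition r_row := 3.
Definition r_aux := 4.
Definition a_slot := 5.
Definition r_cur := 6.
Definition r_found := 7.
Definition r_tmp := 8.

Definition slot_here := IRead a_slot (reg r_row) (IConst 0).
Definition entry c := KRead 0 (reg r_row) c.
Definition abscissa c := CRead 0 c (IConst 0).

(** The working column leads in the current row, and the slot of that row is
    empty or holds a column of larger abscissa.  An empty slot refers to the zero
    column [n], so that its entry is zero. *)
Definition swap_cond :=
  BAnd (BNot (BIsZero (entry (reg r_cur))))
       (BNot (BAnd (BNot (BIsZero (entry slot_here)))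
                   (BCrdLe (abscissa slot_here) (abscissa (reg r_cur))))).

Definition swap :=
  Seq (set_reg r_tmp slot_here)
  (Seq (SetIdx a_slot (reg r_row) (IConst 0) (reg r_cur))
  (Seq (set_reg r_cur (reg r_tmp)) (set_reg r_found (IConst 1)))).

Definition factor := KRead 2 (IConst 0) (IConst 0).

Definition eliminate :=
  Seq (SetScl 2 (IConst 0) (IConst 0) (KDiv (entry (reg r_cur)) (entry slot_here)))
      (for_ r_aux 0
        (SetScl 0 (reg r_aux) (reg r_cur)
          (KSub (KRead 0 (reg r_aux) (reg r_cur))
                (KMul factor (KRead 0 (reg r_aux) slot_here))))).

(** After [swap], the working column may be zero in the current row because the
    slot was empty; hence the second test. *)
Definition row_step :=
  Seq (If swap_cond swap Skip)
      (If (BNot (BIsZero (entry (reg r_cur)))) eliminate Skip).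

(** The column is written to the output before it is reduced in place; it is
    overwritten by the next one unless [column_step] increments the counter. *)
Definition write_column :=
  Seq (for_ r_aux 0
        (SetScl 1 (reg r_aux) (reg r_count) (KRead 0 (reg r_aux) (reg r_col))))
  (Seq (SetCrd 1 (reg r_count) (IConst 0) (CRead 0 (reg r_col) (IConst 0)))
       (SetCrd 1 (reg r_count) (IConst 1) (CRead 0 (reg r_col) (IConst 1)))).

Definition column_step :=
  Seq write_column
  (Seq (set_reg r_cur (reg r_col))
  (Seq (set_reg r_found (IConst 0))
  (Seq (for_ r_row 0 row_step)
       (If (BIdxLe (IConst 1) (reg r_found))
          (set_reg r_count (ISucc (reg r_count))) Skip)))).

Definition min_gens :=
  Seq (for_ r_row 0 (SetIdx a_slot (reg r_row) (IConst 0) (extent 1)))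
      (for_ r_col 1 column_step).

End Program.

(** * Executions with bounded time and memory *)

Section Execution.
Variables (K : fieldType) (m n : nat).
Implicit Types (s : state K) (Q : state K -> Prop).

(** The cells that may be accessed: the first alternative covers the matrices and
    the slots, the second one the labels, the dimensions and the registers.
    The zero column [n] and its label are included. *)
Definition in_box (c : cell) : bool :=
  let: (_, a, i, j) := c in
  (a < 9) && ((i <= m) && (j <= n) || (i <= n) && (j <= 1)).

Definition runs p s T Q : Prop :=
  exists t c s', [/\ exec p s t c s', t <= T, all in_box c & Q s'].

Lemma runs_conseq p s T T' Q Q' : runs p s T Q -> T <= T' ->
  (forall s', Q s' -> Q' s') -> runs p s T' Q'.
Proof.
move=> [t [c [s' [ex tT cb Qs']]]] TT' QQ'; exists t, c, s'; split=> //.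
  exact: leq_trans TT'.
exact: QQ'.
Qed.

Lemma runs_skip s T Q : 0 < T -> Q s -> runs Skip s T Q.
Proof. by move=> T0 Qs; exists 1, [::], s; split=> //; apply: ExecSkip. Qed.

Lemma runs_idx a i j e s T Q : icost i + icost j + icost e < T ->
  all in_box ((Idx, a, ival s i, ival s j) :: ireads s i ++ ireads s j ++ ireads s e) ->
  Q (State (upd (idx s) a (ival s i) (ival s j) (ival s e)) (crd s) (scl s)) ->
  runs (SetIdx a i j e) s T Q.
Proof. by move=> hT hb hQ; do 3!eexists; split; [exact: ExecSetIdx|..]. Qed.

Lemma runs_crd a i j e s T Q : icost i + icost j + ccost e < T ->
  all in_box ((Crd, a, ival s i, ival s j) :: ireads s i ++ ireads s j ++ creads s e) ->
  Q (State (idx s) (upd (crd s) a (ival s i) (ival s j) (cval s e)) (scl s)) ->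
  runs (SetCrd a i j e) s T Q.
Proof. by move=> hT hb hQ; do 3!eexists; split; [exact: ExecSetCrd|..]. Qed.

Lemma runs_scl a i j e s T Q : icost i + icost j + kcost e < T ->
  all in_box ((Scl, a, ival s i, ival s j) :: ireads s i ++ ireads s j ++ kreads s e) ->
  Q (State (idx s) (crd s) (upd (scl s) a (ival s i) (ival s j) (kval s e))) ->
  runs (SetScl a i j e) s T Q.
Proof. by move=> hT hb hQ; do 3!eexists; split; [exact: ExecSetScl|..]. Qed.

Lemma runs_seq p1 p2 s T1 T2 T Q : T1 + T2 <= T ->
  runs p1 s T1 (fun s1 => runs p2 s1 T2 Q) -> runs (Seq p1 p2) s T Q.
Proof.
move=> hT [t1 [c1 [s1 [ex1 tT1 cb1 [t2 [c2 [s2 [ex2 tT2 cb2 Qs2]]]]]]]].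
exists (t1 + t2), (c1 ++ c2), s2; split=> //; first exact: ExecSeq ex1 ex2.
  by apply: leq_trans hT; apply: leq_add.
by rewrite all_cat cb1.
Qed.

Lemma runs_if b p1 p2 s T1 T Q : bcost b + T1 < T -> all in_box (breads s b) ->
  runs (if bval s b then p1 else p2) s T1 Q -> runs (If b p1 p2) s T Q.
Proof.
move=> hT hb [t [c [s' [ex tT cb Qs']]]].
exists (bcost b + t).+1, (breads s b ++ c), s'; split=> //.
- exact: ExecIf.
- by apply: leq_trans hT; rewrite ltnS leq_add2l.
by rewrite all_cat hb.
Qed.

Definition with_reg s a x :=
  State (upd (idx s) a 0 0 x) (crd s) (scl s).

(** Besides the body, an iteration takes 9 units for the test and 7 for the
    increment; the initialization takes 4 and the last test 9. *)
Lemma runs_for a b body N (T : nat -> nat) (I : nat -> state K -> Prop) s :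
  a < 9 -> b <= 1 ->
  (forall i s1, I i s1 -> idx s1 0 0 b = N /\ idx s1 a 0 0 = i) ->
  (forall i s1, i < N -> I i s1 -> runs body s1 (T i)
     (fun s2 => idx s2 a 0 0 = i /\ I i.+1 (with_reg s2 a i.+1))) ->
  I 0 (with_reg s a 0) ->
  runs (for_ a b body) s (\sum_(i < N) (T i + 16) + 13) (I N).
Proof.
move=> a9 b1 Ireg Istep I0.
have abox : in_box (Idx, a, 0, 0) by rewrite /in_box a9.
have dbox : in_box (Idx, 0, 0, b) by rewrite /in_box b1 orbT.
apply: (@runs_seq _ _ _ 4 (\sum_(i < N) (T i + 16) + 9)).
  by rewrite addnC -addnA.
apply: runs_idx => //=; first by rewrite a9.
suff main r i s1 : i + r = N -> I i s1 ->
  runs (While (BIdxLe (ISucc (reg a)) (extent b)) (Seq body (set_reg a (ISucc (reg a)))))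
    s1 (\sum_(i <= k < N) (T k + 16) + 9) (I N).
  by rewrite -(big_mkord xpredT (fun i => T i + 16)); apply: (main N) I0.
elim: r i s1 => [|r IH] i s1.
  rewrite addn0 => -> INs; have [dN ai] := Ireg _ _ INs.
  exists 9, [:: (Idx, a, 0, 0); (Idx, 0, 0, b)], s1.
  split=> //; last by rewrite /= a9 b1 orbT.
    by apply: ExecWhileStop; rewrite /= dN ai ltnn.
  by rewrite leq_addl.
move=> irN Is; have [dN ai] := Ireg _ _ Is.
have iN : i < N by rewrite -irN addnS ltnS leq_addr.
have [t1 [c1 [s2 [ex1 tT1 cb1 [ai2 Is2]]]]] := Istep _ _ iN Is.
have [|t3 [c3 [s3 [ex3 tT3 cb3 Qs3]]]] := IH i.+1 _ _ Is2; first by rewrite addSnnS.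
exists (8 + (t1 + 7) + t3).+1.
exists ([:: (Idx, a, 0, 0); (Idx, 0, 0, b)] ++
        (c1 ++ [:: (Idx, a, 0, 0); (Idx, a, 0, 0)]) ++ c3), s3.
split=> //.
- apply: (@ExecWhileStep _ _ _ s1 _ _ (with_reg s2 a i.+1)) ex3.
    by rewrite /= dN ai.
  apply: (ExecSeq ex1).
  have := ExecSetIdx a (IConst 0) (IConst 0) (ISucc (reg a)) s2.
  by rewrite /= ai2.
- by rewrite big_ltn //; lia.
- by rewrite !all_cat cb1 cb3 /= a9 b1 orbT.
Qed.

(** The state after the first [k] entries of column [c] of the scalar array [a]
    have been overwritten by [f], starting from [s]; only the loop counter may have
    changed otherwise. *)
Definition column_set s a c (f : nat -> K) k s' : Prop :=
  [/\ forall a' i j, a' != r_aux -> idx s' a' i j = idx s a' i j,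
      crd s' = crd s
    & forall a' i j, scl s' a' i j =
        if [&& a' == a, j == c & i < k] then f i else scl s a' i j].

Lemma runs_column a e ke c f s T :
  idx s 0 0 0 = m ->
  icost e + kcost ke + 4 < T ->
  a < 9 -> c <= n ->
  (forall k s1, k < m -> idx s1 r_aux 0 0 = k -> column_set s a c f k s1 ->
     [/\ ival s1 e = c, kval s1 ke = f k & all in_box (ireads s1 e ++ kreads s1 ke)]) ->
  runs (for_ r_aux 0 (SetScl a (reg r_aux) e ke)) s (m * (T + 16) + 13)
    (column_set s a c f m).
Proof.
move=> ms hT a9 cn step.
pose I k s1 := idx s1 r_aux 0 0 = k /\ column_set s a c f k s1.
apply: (@runs_conseq _ _ (\sum_(k < m) (T + 16) + 13) _ (I m)); last 2 first.
- by rewrite sum_nat_const card_ord.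
- by move=> s' [].
apply: (@runs_for _ _ _ _ (fun=> T)) => //.
- by move=> k s1 [sk [si _ _]]; rewrite si.
- move=> k s1 km [sk cs]; have [ec kf box] := step k s1 km sk cs.
  apply: runs_scl => /=; first by lia.
    rewrite sk ec a9 (ltnW km) cn all_cat /=.
    by move: box; rewrite all_cat.
  rewrite sk ec kf; split=> //; split; first by rewrite /= /upd !eqxx.
  case: cs => si sc ss; split=> //= [a' i j aux|a' i j].
    by rewrite /upd (negPf aux) /=; apply: si.
  rewrite /upd ss ltnS.
  case: (a' == a) => //=; case: (j == c); rewrite ?andbT ?andbF //=.
  by case: ltngtP => //= ->.
- split; first by rewrite /= /upd !eqxx.
  split=> //= [a' i j aux|a' i j]; first by rewrite /upd (negPf aux).
  by rewrite !andbF.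
Qed.

End Execution.

(** * Reduction of one column *)

Section Correctness.
Variables (K : fieldType) (m n : nat) (A : bigradedMatrix K m n).
Implicit Types (s : state K).

Local Notation runs := (runs m n).

Definition vec s c : 'cV[K]_m := \col_(i < m) scl s 0 i c.
Definition slots s k := idx s a_slot k 0.
Definition cur s := idx s r_cur 0 0.
Definition found s := 0 < idx s r_found 0 0.

Definition in_vec := vec (input A).
Definition in_x c := crd (input A) 0 c 0.
Definition in_y c := crd (input A) 0 c 1.

Local Notation reducing := (reducing n in_vec in_x).
Local Notation reduced := (reduced n in_vec in_x).

Lemma in_vec_n : in_vec n = 0%R.
Proof. by apply/colP => i; rewrite !mxE /= valK (insubN 'I_n) ?ltnn. Qed.

(** The reduction of a column touches neither the dimensions and the counters of
    columns nor the labels and the output. *)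
Definition same_io s s' : Prop :=
  [/\ forall a i j, a < 3 -> idx s' a i j = idx s a i j, crd s' = crd s
    & forall i j, scl s' 1 i j = scl s 1 i j].

Lemma same_io_trans s2 s1 s3 : same_io s1 s2 -> same_io s2 s3 -> same_io s1 s3.
Proof.
move=> [i1 c1 k1] [i2 c2 k2]; split=> [a i j a3||i j].
- by rewrite i2 ?i1.
- by rewrite c2.
- by rewrite k2.
Qed.

Section Row.
Variables (j : nat) (s0 : state K).
Hypotheses (jn : j < n) (s0m : idx s0 0 0 0 = m).
Hypothesis s0x : forall c, crd s0 0 c 0 = in_x c.

(** The last clause is for the running time: whether the slots from row [i] on
    are empty can be read off from the state [s0] before the reduction. *)
Definition row_inv i s : Prop :=
  [/\ same_io s0 s, idx s r_row 0 0 = i,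
      reducing (vec s) (slots s) j i (cur s) (found s)
    & forall k, i <= k < m -> (slots s k == n) = (slots s0 k == n)].

(** The state between the two parts of [row_step]: if the working column still
    leads in row [i], then slot [i] was occupied at the start and now holds a column
    that can be used for elimination. *)
Definition row_inv_swapped i s : Prop :=
  [/\ same_io s0 s, idx s r_row 0 0 = i,
      reducing (vec s) (slots s) j i (cur s) (found s),
      forall k, i < k < m -> (slots s k == n) = (slots s0 k == n)
    & scl s 0 i (cur s) != 0%R ->
      [/\ scl s 0 i (slots s i) != 0%R, (in_x (slots s i) <= in_x (cur s))%R
        & slots s0 i != n]].

Lemma vecE s c i (im : i < m) : vec s c (Ordinal im) 0%R = scl s 0 i c.
Proof. by rewrite mxE. Qed.

Lemma reducing_slot_le s i k : reducing (vec s) (slots s) j i (cur s) (found s) ->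
  k < m -> slots s k <= n.
Proof.
case=> slots_ok _ _ _ _ _ km.
have [/= ->//|[/= h _]] := slots_ok (Ordinal km); lia.
Qed.

Lemma reducing_cur_le s i : reducing (vec s) (slots s) j i (cur s) (found s) ->
  cur s <= n.
Proof. by case=> _ [->|[h _]] _ _ _ _ //; apply: leq_trans h (ltnW jn). Qed.

(** The time bounds here and below are the evaluation costs, rounded up. *)
Lemma runs_swap i s : i < m -> row_inv i s ->
  runs (If swap_cond swap Skip) s 100 (row_inv_swapped i).
Proof.
move=> im [io si red occ].
have sln := reducing_slot_le red im; have curn := reducing_cur_le red.
have sx c : crd s 0 c 0 = in_x c by case: io => _ -> _; rewrite s0x.
have imW := ltnW im.
have Wn : vec s n = 0%R by apply: (reducing_zero in_vec_n jn red).
have slE : idx s 5 i 0 = slots s i by [].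
have curE : idx s 6 0 0 = cur s by [].
apply: (@runs_if _ _ _ _ _ _ _ 40) => //.
  by rewrite /= !si !slE !curE imW sln curn /= ?orbT.
rewrite /= si slE curE !sx.
case: ifPn => [/andP[curi cond]|]; last first.
  move=> cond; apply: runs_skip => //; split=> //.
    by move=> k /andP[ik km]; apply: occ; rewrite ltnW.
  move=> curi; move: cond; rewrite curi /= negbK => /andP[sli ->]; split=> //.
  rewrite -occ ?leqnn //; apply: contraNneq sli => slin.
  by rewrite slin -(vecE s n im) Wn mxE.
apply: (@runs_seq _ _ _ _ _ _ 10 30) => //; apply: runs_idx => //=.
  by rewrite !si imW.
apply: (@runs_seq _ _ _ _ _ _ 10 20) => //; apply: runs_idx => //=.
  by rewrite /upd /= !si imW.
apply: (@runs_seq _ _ _ _ _ _ 10 10) => //; apply: runs_idx => //=.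
apply: runs_idx => //=.
(* [swap] is done; [s'] is its final state. *)
set s' := State _ _ _.
have curE' : cur s' = slots s i by rewrite /cur /= /upd /= si.
have slE' k : slots s' k = if k == i then cur s else slots s k.
  by rewrite /slots /= /upd /= si andbT; case: eqP.
have redS : reducing (vec s') (slots s') j i (cur s') (found s').
  rewrite curE'.
  apply: (reducing_swap in_vec_n jn (i := Ordinal im) red) => //=.
    by rewrite vecE.
  by rewrite vecE ltNge; move: cond; rewrite negb_and negbK.
split=> //.
- by apply: same_io_trans io _; split=> // a k l; rewrite /= /upd; case: a => [|[|[]]].
- by move=> k /andP[ik km]; rewrite slE' (gtn_eqF ik) occ // (ltnW ik).
rewrite curE' slE' eqxx => sli.
have xlt : (in_x (cur s) < in_x (slots s i))%R.
  by move: cond; rewrite sli /= -ltNge.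
split=> //; first exact: ltW.
rewrite -occ ?leqnn //; apply: contraNneq sli => slin.
by rewrite slin -(vecE s n im) Wn mxE.
Qed.

(** The part of the time proportional to [m] is spent only if the slot was
    occupied at the start.  A step of its loop takes 29 units for the assignment
    and 16 for the control. *)
Lemma runs_eliminate i s : i < m -> row_inv_swapped i s ->
  runs (If (BNot (BIsZero (entry (reg r_cur)))) eliminate Skip) s
    (60 + (slots s0 i != n) * (m * 45))
    (fun s' => idx s' r_row 0 0 = i /\ row_inv i.+1 (with_reg s' r_row i.+1)).
Proof.
move=> im [io si red occ sub].
have sln := reducing_slot_le red im; have curn := reducing_cur_le red.
have imW := ltnW im.
have slE : idx s 5 i 0 = slots s i by [].
have curE : idx s 6 0 0 = cur s by [].
have sm : idx s 0 0 0 = m by case: io => -> //.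
apply: (@runs_if _ _ _ _ _ _ _ (40 + (slots s0 i != n) * (m * 45))) => //.
- by rewrite /=; lia.
- by rewrite /= !si !curE imW curn.
rewrite /= si curE; case: ifPn; last first.
  rewrite negbK => /eqP curi; apply: runs_skip => //; split=> //; split=> //.
  - by apply: same_io_trans io _; split=> // a k l; rewrite /= /upd; case: a => [|[|[]]].
  - apply: (@reducing_skip _ _ _ _ _ _ _ _ (Ordinal im)); first by rewrite vecE.
    exact: red.
move=> curi; have [sli xi ->] := sub curi; rewrite mul1n.
apply: (@runs_seq _ _ _ _ _ _ 21 (m * 45 + 13)); first by lia.
apply: runs_scl => //=; first by rewrite !si curE slE imW curn sln.
rewrite si curE slE /upd /=.
set q := (scl s 0 i (cur s) / scl s 0 i (slots s i))%R.
set s1 := State _ _ _.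
pose f k := (scl s 0 k (cur s) - q * scl s 0 k (slots s i))%R.
(* The loop reads column [slots s i] while it writes column [cur s]. *)
have curN : (slots s i == cur s) = false.
  case: red => _ [E|[_ curN]] _ _ _ rest; last by apply/eqP/(curN (Ordinal im)).
  by move: curi; rewrite E -(vecE s n im) rest // in_vec_n mxE eqxx.
apply: (runs_conseq (Q := column_set s1 0 (cur s) f m) (T := m * 45 + 13)); last 2 first.
- exact: leqnn.
- move=> s' [s'i s'c s'k].
  have slE' k : slots s' k = slots s k by rewrite /slots s'i.
  have curE' : cur s' = cur s by rewrite /cur s'i.
  have fE' : found s' = found s by rewrite /found s'i.
  split; first by rewrite s'i.
  split=> //.
  + apply: same_io_trans io _; split; [move=> a k l a3| |move=> k l] => /=.
    * by rewrite /upd; case: a a3 => [|[|[]]] //= _; rewrite s'i.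
    * by rewrite s'c.
    * by rewrite s'k.
  + apply: (eq_reducing (W := vec s') (sl := slots s)) => //.
    rewrite [cur _]curE' [found _]fE'.
    apply: (reducing_eliminate in_vec_n jn (i := Ordinal im) red).
    * by rewrite vecE.
    * by rewrite vecE.
    * exact: xi.
    move=> c; rewrite !vecE /= -/q; apply/colP => k; rewrite mxE s'k /= ltn_ord andbT.
    by case: (c == cur s); rewrite !mxE.
  + by move=> k km; rewrite [slots _ k]slE' occ.
apply: (@runs_column _ _ _ _ _ _ _ _ _ 29) => //.
move=> k s2 km s2k [s2i s2c s2s]; split.
- by rewrite /= s2i.
- rewrite /= s2k !s2i // si slE !s2s /= curE eqxx ltnn curN /=.
  by rewrite /upd.
- by rewrite /= s2k !s2i // si curE slE (ltnW km) curn imW sln.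
Qed.

Lemma runs_rows s : row_inv 0 (with_reg s r_row 0) ->
  runs (for_ r_row 0 row_step) s
    (\sum_(i < m) (160 + (slots s0 i != n) * (m * 45) + 16) + 13) (row_inv m).
Proof.
apply: (@runs_for _ _ _ _ _ _ _ (fun i => 160 + (slots s0 i != n) * (m * 45))) => //.
  by move=> i s1 [[io _ _] si _ _]; rewrite io.
move=> i s1 im inv.
apply: (@runs_seq _ _ _ _ _ _ 100 (60 + (slots s0 i != n) * (m * 45))).
  by rewrite addnA.
apply: runs_conseq (runs_swap im inv) (leqnn _) _ => s2.
exact: runs_eliminate.
Qed.

End Row.
End Correctness.

(** * The whole run *)

Section Columns.
Variables (K : fieldType) (m n : nat) (A : bigradedMatrix K m n).
Implicit Types (s : state K).

Local Notation runs := (runs m n).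
Local Notation vec := (@vec K m).
Local Notation in_vec := (in_vec A).
Local Notation in_x := (in_x A).
Local Notation in_y := (in_y A).
Local Notation reduced := (reduced n in_vec in_x).
Local Notation row_inv := (row_inv A).

Definition written N s : seq ('cV[K]_m * grade) :=
  [seq ((\col_(i < m) scl s 1 i k)%R, (crd s 1 k 0, crd s 1 k 1)) | k <- iota 0 N].

Definition in_pair j : 'cV[K]_m * grade := (in_vec j, (in_x j, in_y j)).

Definition new_pairs j : seq ('cV[K]_m * grade) :=
  [seq in_pair c | c <- iota 0 j & new_col in_vec in_x c].

Lemma size_written N s : size (written N s) = N.
Proof. by rewrite size_map size_iota. Qed.

Lemma writtenS N s :
  written N.+1 s =
    rcons (written N s) ((\col_(i < m) scl s 1 i N)%R, (crd s 1 N 0, crd s 1 N 1)).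
Proof. by rewrite /written -(addn1 N) iotaD map_cat cats1. Qed.

Lemma eq_written N s s' :
  (forall i k, i < m -> k < N -> scl s' 1 i k = scl s 1 i k) ->
  (forall k b, k < N -> crd s' 1 k b = crd s 1 k b) ->
  written N s' = written N s.
Proof.
move=> es ec; apply/eq_in_map => k; rewrite mem_iota /= => kN.
rewrite !ec //; congr (_, _); apply/colP => i.
by rewrite !mxE es.
Qed.

Lemma new_pairsS j : new_pairs j.+1 =
  if new_col in_vec in_x j then rcons (new_pairs j) (in_pair j) else new_pairs j.
Proof.
rewrite /new_pairs -(addn1 j) iotaD filter_cat map_cat add0n /=.
by case: ifP; rewrite ?cats1 ?cats0.
Qed.

Lemma size_new_pairs j : size (new_pairs j) <= j.
Proof. by rewrite size_map size_filter -[X in _ <= X](size_iota 0) count_size. Qed.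

Definition col_inv j s : Prop :=
  [/\ idx s 0 0 0 = m, idx s 0 0 1 = n, idx s r_col 0 0 = j &
   [/\ forall c b, crd s 0 c b = crd (input A) 0 c b,
      reduced (vec s) (slots s) j & written (idx s r_count 0 0) s = new_pairs j]].

Lemma sum_row_cost j s : j < n -> reduced (vec s) (slots s) j ->
  \sum_(i < m) (160 + (slots s i != n) * (m * 45) + 16) + 13 <=
  m * 176 + minn m n * (m * 45) + 13.
Proof.
move=> jn red; rewrite leq_add2r.
under eq_bigr do rewrite addnAC.
rewrite big_split sum_nat_const card_ord leq_add2l -big_distrl leq_mul2r.
apply/orP; right.
apply: leq_trans (occupied_slots (in_vec_n A) (ltnW jn) red) _.
by rewrite leq_min geq_minl (leq_trans (geq_minr _ _)) // ltnW.
Qed.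

Lemma runs_column_step j s : j < n -> col_inv j s ->
  runs column_step s (100 + m * 207 + minn m n * (m * 45))
    (fun s' => idx s' r_col 0 0 = j /\ col_inv j.+1 (with_reg s' r_col j.+1)).
Proof.
move=> jn [sm sn sj [s_crd red out]].
have cj : idx s 1 0 0 <= j.
  by rewrite -(size_written (idx s 1 0 0) s) out size_new_pairs.
set cnt := idx s 1 0 0 in cj out.
have cn : cnt < n := leq_ltn_trans cj jn.
have cn' := ltnW cn; have jn' := ltnW jn.
apply: (@runs_seq _ _ _ _ _ _ (m * 31 + 33) (m * 176 + minn m n * (m * 45) + 50)).
  by lia.
apply: (@runs_seq _ _ _ _ _ _ (m * 31 + 13) 20); first by lia.
apply: (runs_conseq (T := m * (15 + 16) + 13)
         (Q := column_set s 1 cnt (fun k => scl s 0 k j) m)); last 2 first.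
- by [].
- move=> s1 [s1i s1c s1s].
  apply: (@runs_seq _ _ _ _ _ _ 10 10) => //; apply: runs_crd => //=.
    by rewrite !s1i //= sj -/cnt cn' jn' !orbT.
  apply: runs_crd => //=.
    by rewrite !s1i //= sj -/cnt cn' jn' !orbT.
  rewrite !s1i // sj -/cnt s1c !s_crd.
  apply: (@runs_seq _ _ _ _ _ _ 6 (m * 176 + minn m n * (m * 45) + 44)); first by lia.
  apply: runs_idx => //=.
  rewrite !s1i // sj.
  apply: (@runs_seq _ _ _ _ _ _ 4 (m * 176 + minn m n * (m * 45) + 40)); first by lia.
  apply: runs_idx => //=.
  set s2 := State _ _ _.
  have slE : slots s2 =1 slots s by move=> k; rewrite /slots /= /upd /= s1i.
  have vecE : vec s2 =1 vec s.
    by move=> c; apply/colP => i; rewrite !mxE /= s1s.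
  have red2 : reduced (vec s2) (slots s2) j by apply: eq_reduced red.
  apply: (@runs_seq _ _ _ _ _ _ (m * 176 + minn m n * (m * 45) + 13) 20).
    by lia.
  have s2m : idx s2 0 0 0 = m by rewrite /= /upd /= s1i.
  have s2x c : crd s2 0 c 0 = in_x c by rewrite /= /upd /= s_crd.
  apply: (runs_conseq (runs_rows jn s2m s2x _)).
  + split => //.
    * by split=> // a k l a3; rewrite /= /upd /=; case: a a3 => [|[|[]]].
    * apply: (eq_reducing (W := vec s2) (sl := slots s2)) => //.
      exact: reducing_start red2.
  + exact: sum_row_cost red2.
  move=> s3 [[s3i s3c s3s] s3row red3 _].
  have [red4 foundE] := reducing_end red3.
  (* The entry after the last one of the output holds column [j]. *)
  have w3 : written cnt.+1 s3 = rcons (new_pairs j) (in_pair j).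
    rewrite writtenS -out; congr rcons.
      apply: eq_written => [i k im kcnt|k b kcnt].
        by rewrite s3s /= s1s /= (ltn_eqF kcnt).
      by rewrite s3c /= /upd (ltn_eqF kcnt).
    have -> : crd s3 1 cnt 0 = in_x j by rewrite s3c /= /upd /= !eqxx.
    have -> : crd s3 1 cnt 1 = in_y j by rewrite s3c /= /upd /= !eqxx /= s_crd.
    rewrite /in_pair -(red_rest red (leqnn j)); congr (_, _); apply/colP => i.
    by rewrite !mxE s3s /= s1s /= eqxx ltn_ord.
  have w3' : written cnt s3 = new_pairs j.
    by have := w3; rewrite writtenS => /rcons_inj[].
  have cnt3 : idx s3 1 0 0 = cnt by rewrite s3i //= /upd /= s1i.
  (* Both branches of the last test end in a state of this form. *)
  have fin s4 : (forall a k l, a != 1 -> idx s4 a k l = idx s3 a k l) ->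
      crd s4 = crd s3 -> scl s4 = scl s3 ->
      written (idx s4 1 0 0) s3 = new_pairs j.+1 ->
      idx s4 r_col 0 0 = j /\ col_inv j.+1 (with_reg s4 r_col j.+1).
    move=> s4i s4c s4s out4; split; first by rewrite s4i // s3i //= /upd /= s1i.
    split; rewrite /= /upd /=.
    - by rewrite s4i // s3i //= s2m.
    - by rewrite s4i // s3i //= /upd /= s1i.
    - by [].
    split.
    - by move=> c b; rewrite s4c s3c /= /upd /= s_crd.
    - apply: eq_reduced red4 => [c|k]; last by rewrite /slots /= /upd /= s4i.
      by apply/colP => i; rewrite !mxE /= s4s.
    rewrite -out4 /r_count; apply: eq_written => *; first by rewrite /= s4s.
    by rewrite /= s4c.
  apply: (@runs_if _ _ _ _ _ _ _ 10) => //.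
  rewrite [bval _ _]foundE.
  have newS := new_pairsS j; move: newS; case: ifP => _ newS.
    apply: runs_idx => //.
    apply: fin => // [a k l a1|]; first by rewrite /= /upd (negPf a1).
    by rewrite /upd /= cnt3 w3 newS.
  by apply: runs_skip => //; apply: fin; rewrite ?cnt3 ?w3'.
apply: runs_column => //.
move=> k s1 km s1k [s1i s1c s1s]; split.
- by rewrite /= s1i.
- by rewrite /= s1k s1i // sj s1s.
- by rewrite /= s1k !s1i // sj jn' (ltnW km).
Qed.

Lemma reduced_start s : vec s =1 in_vec -> (forall k : 'I_m, slots s k = n) ->
  reduced (vec s) (slots s) 0.
Proof.
move=> vecE slE; split=> [k|t|c _]; last exact: vecE.
  by left; apply: slE.
rewrite /prefix_span big_ord0 /slot_span big1 // => k _.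
by rewrite slE vecE in_vec_n; apply/eqP; rewrite -subv0 -memvE mem0v.
Qed.

Lemma runs_init : runs (for_ r_row 0 (SetIdx a_slot (reg r_row) (IConst 0) (extent 1)))
  (input A) (m * 25 + 13) (fun s => col_inv 0 (with_reg s r_col 0)).
Proof.
pose I i s := [/\ idx s r_row 0 0 = i,
  forall a k l, a != r_row -> a != a_slot -> idx s a k l = idx (input A) a k l,
  crd s = crd (input A), scl s = scl (input A)
  & forall k, k < i -> slots s k = n].
apply: (runs_conseq (Q := I m) (T := \sum_(i < m) (9 + 16) + 13)).
- apply: (@runs_for _ _ _ _ _ _ _ (fun=> 9)) => //.
  + by move=> i s [-> si _ _ _]; rewrite si.
  + move=> i s im [si sN sc ss sl]; apply: runs_idx => //=.
      by rewrite si (ltnW im) orbT.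
    rewrite si sN //; split; first by rewrite /upd.
    split=> //.
      by move=> a k l a3 a5; rewrite /= /upd (negPf a3) (negPf a5) /= sN.
    move=> k; rewrite ltnS /slots /= /upd /= andbT; case: ltngtP => //= ki _.
    exact: sl.
  by split=> // a k l a3 a5; rewrite /= /upd (negPf a3).
- by rewrite sum_nat_const card_ord.
move=> s [si sN sc ss sl]; split; rewrite /= /upd /= ?sN //.
split; first by rewrite sc.
  apply: reduced_start => [c|k]; last by rewrite /slots /= /upd /= [LHS]sl.
  by apply/colP => i; rewrite !mxE /= ss.
by [].
Qed.

Lemma runs_min_gens : runs min_gens (input A)
  (m * 25 + 13 + (n * (116 + m * 207 + minn m n * (m * 45)) + 13)) (col_inv n).
Proof.
apply: runs_seq (leqnn _) _; apply: runs_conseq runs_init (leqnn _) _ => s inv.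
apply: (runs_conseq (Q := col_inv n)
  (T := \sum_(j < n) (100 + m * 207 + minn m n * (m * 45) + 16) + 13)) => //.
- apply: (@runs_for _ _ _ _ _ _ _ (fun=> 100 + m * 207 + minn m n * (m * 45))) => //.
    by move=> j s1 [].
  by move=> j s1; apply: runs_column_step.
- by rewrite sum_nat_const card_ord; lia.
Qed.

Lemma new_colE (j : 'I_n) : new_col in_vec in_x j = col_sel A j.
Proof.
have vE (i : 'I_n) : in_vec i = col i A.
  by apply/colP => k; rewrite !mxE /= !valK.
have xE (i : 'I_n) : in_x i = (bg_label A i).1 by rewrite /in_x /= valK.
rewrite /new_col /col_sel vE; set V := prefix_span _ _ _ _.
set V' := (\sum_(i < n | _) _)%VS.
suff -> : V = V' by [].
rewrite /V /prefix_span (big_ord_widen_cond n (fun c => in_x c <= in_x j)%R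
           (fun c => <[in_vec c]>%VS)) ?(ltnW (ltn_ord j)) //.
by apply: eq_big => [i|i _]; rewrite ?vE // !xE andbC.
Qed.

Lemma new_pairsE : new_pairs n = selected_columns A.
Proof.
rewrite /new_pairs /selected_columns -val_enum_ord filter_map -map_comp.
rewrite (@eq_filter _ (preim val _) _ new_colE).
apply: eq_map => j; rewrite /= /in_pair /in_x /in_y /= !valK.
rewrite -surjective_pairing; congr (_, _).
by apply/colP => k; rewrite !mxE /= !valK.
Qed.

End Columns.

(** * Resources and the theorem *)

Definition box m n : seq cell :=
  [seq (ka, p.1, p.2) | ka <- [seq (k, a) | k <- [:: Idx; Crd; Scl], a <- iota 0 9],
     p <- [seq (i, j) | i <- iota 0 m.+1, j <- iota 0 n.+1] ++
          [seq (i, j) | i <- iota 0 n.+1, j <- iota 0 2]].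

Lemma in_boxP m n c : in_box m n c -> c \in box m n.
Proof.
case: c => -[[k a] i] j /andP[a9 ij].
apply: (allpairs_f (fun ka (p : nat * nat) => (ka, p.1, p.2))
  (x := (k, a)) (y := (i, j))).
  by apply: allpairs_f; [case: k|rewrite mem_iota].
rewrite mem_cat; apply/orP; case/orP: ij => /andP[hi hj]; [left|right];
by apply: allpairs_f; rewrite mem_iota.
Qed.

Lemma memory_in_box m n c : 0 < m * n -> all (in_box m n) c ->
  memory_used c <= 500 * (m * n).
Proof.
rewrite muln_gt0 => /andP[m0 n0] /allP cbox.
apply: (@leq_trans (size (box m n))).
  apply: uniq_leq_size; first exact: undup_uniq.
  by move=> x; rewrite mem_undup => /cbox/in_boxP.
rewrite size_allpairs size_allpairs size_cat !size_allpairs !size_iota /=.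
by nia.
Qed.

Lemma time_bound m n : 0 < n ->
  m * 25 + 13 + (n * (116 + m * 207 + minn m n * (m * 45)) + 13) <=
  500 * (m * n * minn m n + n ^ 2).
Proof.
move=> n0; have [->|m0] := posnP m; first by rewrite min0n; nia.
have : 0 < minn m n by rewrite leq_min m0.
move: (minn m n) => q q0.
have h1 : m <= m * n * q by rewrite -mulnA leq_pmulr // muln_gt0 n0.
have h2 : m * n <= m * n * q by rewrite leq_pmulr.
have h3 : n <= n ^ 2 by rewrite expnS expn1 leq_pmulr.
have h4 : 0 < n ^ 2 by rewrite expn_gt0 n0.
rewrite (_ : n * _ = n * 116 + m * n * 207 + m * n * q * 45); last by lia.
by lia.
Qed.

Local Close Scope nat_scope.

Theorem mainTheorem2 (K : fieldType) :
  exists (p : cmd) (C : nat),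
    forall (m n : nat) (A : bigradedMatrix K m n)
      (F F' : bipersModule K) (gamma : bipersMorphism F F')
      (B : 'I_n -> F) (gr : 'I_n -> grade)
      (B' : 'I_m -> F') (gr' : 'I_m -> grade),
      free_module F -> finitely_generated F ->
      free_module F' -> finitely_generated F' ->
      ordered_basis B gr -> ordered_basis B' gr' ->
      represents A gamma B gr B' gr' ->
      exists (t : nat) (c : seq cell) (s : state K),
        [/\ exec p (input A) t c s,
            lists_minimal_generators gamma B' gr' (output m s),
            (0 < n)%N -> (t <= C * (m * n * minn m n + n ^ 2))%N
          & (0 < m * n)%N -> (memory_used c <= C * (m * n))%N].
Proof.
exists min_gens, 500%N => m n A F F' gamma B gr B' gr' _ _ freeF' _ basB basB' repA.
have [t [c [s [ex tT cbox [_ _ _ [_ _ out]]]]]] := runs_min_gens A.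
exists t, c, s; split=> //.
- rewrite [output m s]out new_pairsE.
  exact: selected_columns_minimal freeF' basB basB' repA.
- by move=> n0; apply: leq_trans tT (time_bound m n0).
- by move=> mn0; apply: memory_in_box cbox.
Qed.
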